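(* Let $K$ be a nonarchimedean local field with ring of integers $\mathfrak o_K$, uniformizer $\pi$, residue field of cardinality $q$, and valuation $v_K$ normalized by $v_K(\pi)=1$. Let $F$ be a Lubin--Tate formal $\mathfrak o_K$-module associated with $\pi$, let $\operatorname{Tr}_{Co}$ be its Coleman trace, and let $\mathfrak F_{s,m}^F(g)$ be the coefficient of $T^m$ in $\operatorname{Tr}_{Co}^s(g)$. Let $s,n\in\mathbb N_{>0}$. (i) For every $m\in\mathbb N$, $$v_K\left(\mathfrak F_{s,m}^F(T^n)\right)\ge\left\lfloor\frac{n-q^{s-1}-mq^s}{(q-1)q^{s-1}}\right\rfloor_+.$$ (ii) For every $m\in\mathbb Z$ with $m\ge-n$, $$v_K\left(\mathfrak F_{s,m}^F(T^{-n})\right)\ge\left\lfloor\frac{(q-1)(1-s-sm)-m-n-1}{q-1}\right\rfloor_+.$$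
   Context: $\mathbb N=\{0,1,2,\dots\}$. For $x\in\mathbb R$, $\lfloor x\rfloor_+=\max\{0,\lfloor x\rfloor\}$. A Lubin--Tate formal $\mathfrak o_K$-module associated with $\pi$ is a formal $\mathfrak o_K$-module $F$ over $\mathfrak o_K$ with $[\pi]_F(T)\equiv\pi T\pmod{T^2}$ and $[\pi]_F(T)\equiv T^q\pmod\pi$. $F[\pi]=\{a\in\overline K\mid[\pi]_F(a)=0\}$ (roots in the maximal ideal), and $+_F$ is addition for $F$. $\mathcal R_K$ is the ring of Laurent series $\sum_{n\in\mathbb Z}a_nT^n$ with $a_n\in\mathfrak o_K$ and $\lim_{n\to\infty}v_K(a_{-n})=\infty$, and $\mathcal Q_K=\mathcal R_K[1/\pi]$. The Coleman trace $\operatorname{Tr}_{Co}:\mathcal Q_K\to\mathcal Q_K$, $g\mapsto h$, is characterized by $$h([\pi]_F(T))=\frac1\pi\sum_{a\in F[\pi]}g(a+_FT),$$ and $\operatorname{Tr}_{Co}^s$ is its $s$-fold iterate. *)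

(* Defs.v *)
From HB Require Import structures.
From mathcomp Require Import all_boot all_order all_algebra.
From mathcomp Require Import boolp classical_sets functions cardinality fsbigop.
From mathcomp Require Import mpoly.

Set Implicit Arguments.
Unset Strict Implicit.
Unset Printing Implicit Defensive.

Import Order.TTheory GRing.Theory Num.Theory.
Local Open Scope ring_scope.

(* Rank one valuations, written additively.  The value [v 0], which should be
   +oo, is left unspecified: all inequalities go through [vge] and [vgt],
   which hold at 0 by convention. *)
Record valuation (E : fieldType) := Valuation {
  vfun :> E -> rat;
  vfunM : forall x y, x != 0 -> y != 0 -> vfun (x * y) = vfun x + vfun y;
  vfunD : forall x y, x != 0 -> y != 0 -> x + y != 0 ->
    Num.min (vfun x) (vfun y) <= vfun (x + y)
}.

Section ValuedField.
Variables (E : fieldType) (v : valuation E).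

Definition vge (x : E) (c : rat) : bool := (x == 0) || (c <= v x).
Definition vgt (x : E) (c : rat) : bool := (x == 0) || (c < v x).

Definition vint (x : E) : bool := vge x 0.

Definition vcvg (u : nat -> E) (l : E) : Prop :=
  forall c : rat, exists N : nat,
  forall n : nat, (N <= n)%N -> vge (u n - l) c.

Definition vcauchy (u : nat -> E) : Prop :=
  forall c : rat, exists N : nat,
  forall m n : nat, (N <= m)%N -> (N <= n)%N -> vge (u m - u n) c.

Definition vlim (u : nat -> E) : E := xget 0 [set l | vcvg u l]%classic.

(* The residue field, as a set of cosets of the maximal ideal. *)
Definition residue_classes : set (set E) :=
  [set [set y | vgt (y - x) 0] | x in [set x | vint x]]%classic.

(* A nonarchimedean local field with uniformizer [pi], residue field of
   cardinality [q] and normalized valuation [v]. *)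
Record local_field (pi : E) (q : nat) : Prop := LocalField {
  lf_pi_neq0 : pi != 0;
  lf_pi : v pi = 1;
  lf_discrete : forall x : E, x != 0 -> exists z : int, v x = z%:~R;
  lf_complete : forall u : nat -> E, vcauchy u -> exists l : E, vcvg u l;
  lf_residue : (residue_classes #= `I_q)%card
}.

End ValuedField.

(* Formal power series in n variables, given by their coefficients. *)
Definition mps (n : nat) (R : Type) : Type := 'X_{1..n} -> R.

Section PowerSeries.
Variable R : comNzRingType.

Definition mps_var (n : nat) (i : 'I_n) : mps n R :=
  fun m => (m == U_(i)%MM)%:R.

Definition mps_trunc (n N : nat) (f : mps n R) : {mpoly R[n]} :=
  \sum_(m : 'X_{1..n < N}) f m *: 'X_[m].

(* Substitution of the series [g i], without constant terms, for the variables
   of [f]: terms of degree > mdeg m do not contribute to the coefficient at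
   [m].  The definition is meaningful only if the [g i] have no constant
   term. *)
Definition mps_comp (k n : nat) (f : mps k R) (g : 'I_k -> mps n R) : mps n R :=
  fun m => (mps_trunc (mdeg m).+1 f
              \mPo [tuple mps_trunc (mdeg m).+1 (g i) | i < k])@_m.

Definition mps_comp1 (n : nat) (f : mps 1 R) (A : mps n R) : mps n R :=
  mps_comp f (fun=> A).

Definition mps_comp2 (n : nat) (f : mps 2 R) (A B : mps n R) : mps n R :=
  mps_comp f (fun i => if i == ord0 then A else B).

Definition coef1 (f : mps 1 R) (j : nat) : R := f [multinom j | _ < 1].

(* The coefficient of X^i Y^j. *)
Definition coef2 (f : mps 2 R) (i j : nat) : R :=
  f [multinom (if k == ord0 then i else j) | k < 2].

End PowerSeries.

Section FormalModule.
Variables (E : fieldType) (v : valuation E).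

Let T : mps 1 E := mps_var E ord0.
Let X (i : 'I_2) : mps 2 E := mps_var E i.
Let Y (i : 'I_3) : mps 3 E := mps_var E i.

(* One-dimensional commutative formal modules over the valuation ring o of [v].
   [fm_act a] is the series [a]_F; only its values at [a] in o matter. *)
Record formal_module := FormalModule {
  fm_law : mps 2 E;
  fm_act : E -> mps 1 E;
  fm_law_int : forall m, vint v (fm_law m);
  fm_law0 : mps_comp2 fm_law T (fun=> 0) = T;
  fm_lawC : mps_comp2 fm_law (X (inord 1)) (X (inord 0)) = fm_law;
  fm_lawA :
    mps_comp2 fm_law (mps_comp2 fm_law (Y (inord 0)) (Y (inord 1))) (Y (inord 2))
    = mps_comp2 fm_law (Y (inord 0)) (mps_comp2 fm_law (Y (inord 1)) (Y (inord 2)));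
  fm_act_int : forall a, vint v a -> forall m, vint v (fm_act a m);
  fm_act_coef0 : forall a, vint v a -> coef1 (fm_act a) 0 = 0;
  fm_act_coef1 : forall a, vint v a -> coef1 (fm_act a) 1 = a;
  fm_act_law : forall a, vint v a ->
    mps_comp1 (fm_act a) fm_law
    = mps_comp2 fm_law (mps_comp1 (fm_act a) (X (inord 0)))
                       (mps_comp1 (fm_act a) (X (inord 1)));
  fm_act1 : fm_act 1 = T;
  fm_actD : forall a b, vint v a -> vint v b ->
    fm_act (a + b) = mps_comp2 fm_law (fm_act a) (fm_act b);
  fm_actM : forall a b, vint v a -> vint v b ->
    fm_act (a * b) = mps_comp1 (fm_act a) (fm_act b)
}.

(* The congruence [pi]_F(T) = pi T mod T^2 is part of [formal_module]. *)
Definition lubin_tate (pi : E) (q : nat) (F : formal_module) : Prop :=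
  forall j : nat, vge v (coef1 (fm_act F pi) j - (j == q)%:R) (v pi).

End FormalModule.

(* Doubly infinite Laurent series. *)
Definition laurent (R : Type) : Type := int -> R.

Section Laurent.
Variables (E : fieldType) (v : valuation E).

Definition laurent_of_ps (f : nat -> E) : laurent E :=
  fun m => if m is Posz j then f j else 0.

(* The monomial T^k. *)
Definition lmono (k : int) : laurent E := fun m => (m == k)%:R.

(* The ring R_E of the integral Laurent series whose coefficients tend to 0
   at -oo, and Q_E := R_E[1/pi]. *)
Definition in_R (g : laurent E) : Prop :=
  (forall m, vint v (g m)) /\ vcvg v (fun k => g (- k%:Z)) 0.

Definition in_Q (pi : E) (g : laurent E) : Prop :=
  exists k : nat, in_R (fun m => pi ^+ k * g m).

Definition lpartial (f : int -> E) (N : nat) : E :=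
  \sum_(i < N.*2.+1) f (i%:Z - N%:Z).

Definition lsum (f : int -> E) : E := vlim v (lpartial f).

Definition lmul (f g : laurent E) : laurent E :=
  fun m => lsum (fun i => f i * g (m - i)).

(* The inverse of [f] in R_E.  The sums are asked to converge explicitly, so
   that the default value 0 of [vlim] cannot pass for a limit. *)
Definition linv (f : laurent E) : laurent E :=
  xget (fun=> 0) [set g | in_R g /\
    forall m : int, vcvg v (lpartial (fun i => f i * g (m - i))) (lmono 0 m)]%classic.

Definition lpow (f : laurent E) (k : int) : laurent E :=
  match k with
  | Posz n => iter n (lmul f) (lmono 0)
  | Negz n => iter n.+1 (lmul (linv f)) (lmono 0)
  end.

(* Substitution g(u(T)), with coefficientwise convergence. *)
Definition lcomp (g u : laurent E) : laurent E :=
  fun m => lsum (fun k => g k * lpow u k m).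

End Laurent.

(* [L] is an algebraic closure of [K], and [vL] the extension of [vK] to it. *)
Definition alg_closure (K : fieldType) (L : closedFieldType)
    (iota : {rmorphism K -> L}) : Prop :=
  forall x : L, algebraicOver iota x.

Definition extends_val (K L : fieldType) (iota : {rmorphism K -> L})
    (vK : valuation K) (vL : valuation L) : Prop :=
  forall x : K, x != 0 -> vL (iota x) = vK x.

Section Coleman.
Variables (K : fieldType) (vK : valuation K) (L : closedFieldType).
Variables (vL : valuation L) (iota : {rmorphism K -> L}) (pi : K).
Variable F : formal_module vK.

(* F[pi] *)
Definition torsion : set L :=
  [set a | vgt vL a 0 /\
     vcvg vL (fun N => \sum_(j < N) iota (coef1 (fm_act F pi) j) * a ^+ j) 0]%classic.

(* The series a +_F T = F(a, T). *)
Definition translate (a : L) : laurent L :=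
  laurent_of_ps (fun j =>
    vlim vL (fun N => \sum_(i < N) iota (coef2 (fm_law F) i j) * a ^+ i)).

(* [Tr] is the Coleman trace; only its restriction to Q_K matters. *)
Definition is_coleman_trace (Tr : laurent K -> laurent K) : Prop :=
  forall g : laurent K, in_Q vK pi g ->
    in_Q vK pi (Tr g) /\
    forall m : int,
      iota (lcomp vK (Tr g) (laurent_of_ps (coef1 (fm_act F pi))) m)
      = (iota pi)^-1 *
        \sum_(a \in torsion) lcomp vL (fun k => iota (g k)) (translate a) m.

End Coleman.

Definition floor_plus (x : rat) : int := Num.max 0 (Num.floor x).

(* Main.v *)
(* Write phi for [pi]_F and w = 1/(q-1).  Weierstrass preparation and
   phi(a +_F T) = phi(T) show that F[pi] consists of q elements of valuation at
   least w.  Give T the weight w: then a +_F T has Gauss valuation at least w and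
   phi(T) = pi T + ... + T^q + ... at least qw.  So if v(g_k) >= C - kw for all k,
   then pi^-1 sum_a g(a +_F T) has Gauss valuation at least C - 1, and since
   phi^i = pi^i T^i + ..., comparing coefficients from the lowest one upwards in
   h(phi) = pi^-1 sum_a g(a +_F T) gives v(h_m) >= C - 1 - mqw for h = Tr g.
   Moreover h is integral when g is, because all q conjugates g(a +_F T) agree with
   g modulo the maximal ideal, q is divisible by pi, and phi = T^q modulo pi.
   Poles are removed with phi(T)^n = phi(a +_F T)^n, which moreover shows that the
   coefficients of g of index > m do not contribute to h_m when m < 0.
   Iterating this step, with the best C each time, yields both bounds. *)

Require Import Defs.
From HB Require Import structures.
From mathcomp Require Import all_boot all_order all_algebra.
From mathcomp Require Import separable.
From mathcomp Require Import boolp classical_sets functions cardinality fsbigop.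
From mathcomp Require Import mpoly.
From mathcomp Require Import zify ring lra.

Set Implicit Arguments.
Unset Strict Implicit.
Unset Printing Implicit Defensive.

Import Order.TTheory GRing.Theory Num.Theory.
Local Open Scope ring_scope.

(** * Valuations, limits and sums *)

(** The weight w is the one at which pi T and T^q balance: 1 + w = qw. The main obstacle is
    convergence in L: [vlim] and [xget] return a default value when nothing converges, so every
    limit behind the trace has to be shown to exist, in a field that is not complete. For each
    torsion point a this is done in the complete subring K(a), with a ring of Laurent series of its
    own; the conjugates g(a +_F T) for different a meet only as coefficients in L. That the q roots
    are distinct comes from the coefficient of T in phi(a +_F T) = phi(T): it reads phi'(a) F_Y(a,
    0) = pi and excludes multiple roots in any characteristic. Negative powers of a +_F T are made
    explicit by the value psi of phi(X)/X at X = a +_F T: as (a +_F T) psi = phi, the inverse is psi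
    / phi. In the iteration one C must serve all coefficients that contribute to h_m. For T^n the
    bound is combined with integrality at every step, whence the floor of n / q^s; for T^(-n) and m
    < 0 only indices at most m matter, and C is chosen anew for each m. *)

Section Valuation.
Variables (E : fieldType) (v : valuation E).
Implicit Types (x y l : E) (c d : rat) (u : nat -> E).

Lemma vfun1 : v 1 = 0.
Proof.
have := vfunM v (oner_neq0 E) (oner_neq0 E); rewrite mulr1 => h.
by apply: (addrI (v 1)); rewrite -h addr0.
Qed.

Lemma vfunN x : v (- x) = v x.
Proof.
have [->|x0] := eqVneq x 0; first by rewrite oppr0.
have n10 : (-1 : E) != 0 by rewrite oppr_eq0 oner_neq0.
have h : v (-1) = 0.
  by have := vfunM v n10 n10; rewrite mulrNN mulr1 vfun1 => h; lra.
by rewrite -mulN1r vfunM // h add0r.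
Qed.

Lemma vfunV x : x != 0 -> v x^-1 = - v x.
Proof.
move=> x0; have := vfunM v x0 (invr_neq0 x0); rewrite divff // vfun1 => h.
lra.
Qed.

Lemma vfunX x n : x != 0 -> v (x ^+ n) = n%:R * v x.
Proof.
move=> x0; elim: n => [|n IH]; first by rewrite vfun1 mul0r.
by rewrite exprS vfunM ?expf_neq0 // IH -natr1 mulrDl mul1r addrC.
Qed.

Lemma vge0 c : vge v 0 c.
Proof. by rewrite /vge eqxx. Qed.

Lemma vge_val x c : x != 0 -> vge v x c = (c <= v x).
Proof. by rewrite /vge => /negPf ->. Qed.

Lemma vge_le d c x : c <= d -> vge v x d -> vge v x c.
Proof.
by move=> cd /orP[/eqP->|h]; [exact: vge0|rewrite /vge (le_trans cd h) orbT].
Qed.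

Lemma vgeN x c : vge v (- x) c = vge v x c.
Proof. by rewrite /vge oppr_eq0 vfunN. Qed.

Lemma vgeD x y c : vge v x c -> vge v y c -> vge v (x + y) c.
Proof.
have [->|x0] := eqVneq x 0; first by rewrite add0r.
have [->|y0] := eqVneq y 0; first by rewrite addr0.
have [->|s0] := eqVneq (x + y) 0; first by rewrite vge0.
rewrite !vge_val // => hx hy; apply: le_trans (vfunD v x0 y0 s0).
by rewrite le_min hx.
Qed.

Lemma vgeB x y c : vge v x c -> vge v y c -> vge v (x - y) c.
Proof. by move=> hx hy; apply: vgeD; rewrite ?vgeN. Qed.

Lemma vge_subC x y c : vge v (x - y) c = vge v (y - x) c.
Proof. by rewrite -vgeN opprB. Qed.

Lemma vge_trans y x z c : vge v (x - y) c -> vge v (y - z) c -> vge v (x - z) c.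
Proof. by move=> h1 h2; rewrite -(subrKA y) vgeD. Qed.

Lemma vge_sub x y c : vge v (x - y) c -> vge v y c -> vge v x c.
Proof. by move=> h1 h2; rewrite -(subrK y x) vgeD. Qed.

Lemma vgeM x y c d : vge v x c -> vge v y d -> vge v (x * y) (c + d).
Proof.
have [->|x0] := eqVneq x 0; first by rewrite mul0r !vge0.
have [->|y0] := eqVneq y 0; first by rewrite mulr0 !vge0.
by rewrite !vge_val ?mulf_neq0 // => hx hy; rewrite vfunM // lerD.
Qed.

Lemma vgeMl x y c : vint v x -> vge v y c -> vge v (x * y) c.
Proof. by move=> hx hy; rewrite -(add0r c); apply: vgeM. Qed.

Lemma vgeMr x y c : vge v x c -> vint v y -> vge v (x * y) c.
Proof. by move=> hx hy; rewrite -(addr0 c); apply: vgeM. Qed.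

Lemma vint1 : vint v 1.
Proof. by rewrite /vint vge_val ?oner_neq0 // vfun1. Qed.

Lemma vint_nat (n : nat) : vint v n%:R.
Proof.
by elim: n => [|n IH]; [exact: vge0|rewrite -natr1; apply: vgeD => //; exact: vint1].
Qed.

Lemma vgeX x c n : vge v x c -> vge v (x ^+ n) (n%:R * c).
Proof.
move=> h; elim: n => [|n IH]; first by rewrite mul0r; exact: vint1.
by rewrite exprS -nat1r mulrDl mul1r vgeM.
Qed.

Lemma vge_sum (I : Type) (r : seq I) (P : pred I) (F : I -> E) c :
  (forall i, P i -> vge v (F i) c) -> vge v (\sum_(i <- r | P i) F i) c.
Proof.
move=> h; elim/big_rec: _ => [|i x Pi hx]; first exact: vge0.
by rewrite vgeD // h.
Qed.

Lemma vge_inf x : (forall c, vge v x c) -> x = 0.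
Proof.
move=> h; apply/eqP/negPn/negP => x0.
by have := h (v x + 1); rewrite vge_val // gerDl ler10.
Qed.

Lemma eq_vge x y : (forall c, vge v (x - y) c) -> x = y.
Proof. by move=> /vge_inf/eqP; rewrite subr_eq0 => /eqP. Qed.

Lemma vcvg_cst l : vcvg v (fun=> l) l.
Proof. by move=> c; exists 0%N => n _; rewrite subrr vge0. Qed.

Lemma vcvg_unique u l l' : vcvg v u l -> vcvg v u l' -> l = l'.
Proof.
move=> h h'; apply: eq_vge => c; have [N hN] := h c; have [N' hN'] := h' c.
apply: (@vge_trans (u (maxn N N'))).
  by rewrite vge_subC; apply: hN; rewrite leq_maxl.
by apply: hN'; rewrite leq_maxr.
Qed.

Lemma vlimE u l : vcvg v u l -> vlim v u = l.
Proof.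
move=> h; rewrite /vlim; apply: (@vcvg_unique u) => //.
by case: xgetP => [y _ //|/(_ l)].
Qed.

Lemma vcvg_near u u' l : vcvg v u l ->
  (forall c, exists N, forall n, (N <= n)%N -> vge v (u' n - u n) c) ->
  vcvg v u' l.
Proof.
move=> h h' c; have [N hN] := h c; have [N' hN'] := h' c.
exists (maxn N N') => n; rewrite geq_max => /andP[n1 n2].
by apply: (@vge_trans (u n)); [exact: hN'|exact: hN].
Qed.

Lemma vcvg_eventually u u' l N : vcvg v u l ->
  (forall n, (N <= n)%N -> u' n = u n) -> vcvg v u' l.
Proof.
move=> h h'; apply: (vcvg_near h) => c; exists N => n /h' ->.
by rewrite subrr vge0.
Qed.

Lemma eq_vcvg u u' l : u =1 u' -> vcvg v u l -> vcvg v u' l.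
Proof. by move=> e h; apply: (vcvg_eventually (N := 0) h). Qed.

Lemma vcvgD u u' l l' :
  vcvg v u l -> vcvg v u' l' -> vcvg v (fun n => u n + u' n) (l + l').
Proof.
move=> h h' c; have [N hN] := h c; have [N' hN'] := h' c.
exists (maxn N N') => n; rewrite geq_max => /andP[n1 n2].
by rewrite opprD addrACA vgeD ?hN ?hN'.
Qed.

Lemma vcvgMl a u l : vcvg v u l -> vcvg v (fun n => a * u n) (a * l).
Proof.
move=> h c; have [->|a0] := eqVneq a 0.
  by exists 0%N => n _; rewrite !mul0r subrr vge0.
have [N hN] := h (c - v a); exists N => n /hN h'.
have -> : c = v a + (c - v a) by ring.
by rewrite -mulrBr vgeM // vge_val.
Qed.

Lemma vcvgN u l : vcvg v u l -> vcvg v (fun n => - u n) (- l).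
Proof.
by move=> /(@vcvgMl (-1)); rewrite mulN1r; apply: eq_vcvg => n; rewrite mulN1r.
Qed.

Lemma vcvgB u u' l l' :
  vcvg v u l -> vcvg v u' l' -> vcvg v (fun n => u n - u' n) (l - l').
Proof. by move=> h h'; apply: vcvgD => //; exact: vcvgN. Qed.

Lemma vcvg_sum (I : Type) (r : seq I) (P : pred I) (F : I -> nat -> E) (f : I -> E) :
  (forall i, P i -> vcvg v (F i) (f i)) ->
  vcvg v (fun n => \sum_(i <- r | P i) F i n) (\sum_(i <- r | P i) f i).
Proof.
move=> h; elim: r => [|i r IH].
  by rewrite big_nil; apply: (eq_vcvg _ (vcvg_cst 0)) => n; rewrite big_nil.
rewrite big_cons; case: ifP => Pi.
  by apply: (eq_vcvg _ (vcvgD (h i Pi) IH)) => n; rewrite big_cons Pi.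
by apply: (eq_vcvg _ IH) => n; rewrite big_cons Pi.
Qed.

Lemma vcvg_vge u l c N : vcvg v u l ->
  (forall n, (N <= n)%N -> vge v (u n) c) -> vge v l c.
Proof.
move=> h h'; have [N' hN'] := h c.
have := hN' (maxn N N'); rewrite leq_maxr vge_subC => /(_ isT)/vge_sub; apply.
by apply: h'; rewrite leq_maxl.
Qed.

Lemma vcvg_cauchy u l : vcvg v u l -> vcauchy v u.
Proof.
move=> h c; have [N hN] := h c; exists N => m n hm hn.
by apply: (@vge_trans l); [exact: hN|rewrite vge_subC; exact: hN].
Qed.

Lemma vcauchy_near u u' : vcauchy v u ->
  (forall c, exists N, forall n, (N <= n)%N -> vge v (u' n - u n) c) ->
  vcauchy v u'.
Proof.
move=> h h' c; have [N hN] := h c; have [N' hN'] := h' c.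
exists (maxn N N') => m n; rewrite !geq_max => /andP[m1 m2] /andP[n1 n2].
apply: (@vge_trans (u m)); first exact: hN'.
apply: (@vge_trans (u n)); first exact: hN.
by rewrite vge_subC hN'.
Qed.

Lemma vcauchyS u :
  (forall c, exists N, forall n, (N <= n)%N -> vge v (u n.+1 - u n) c) ->
  vcauchy v u.
Proof.
move=> h c; have [N hN] := h c; exists N.
suff H n : (N <= n)%N -> vge v (u n - u N) c.
  move=> m n /H hm /H hn; apply: (@vge_trans (u N)) => //.
  by rewrite vge_subC.
elim: n => [|n IH]; first by rewrite leqn0 => /eqP ->; rewrite subrr vge0.
rewrite leq_eqVlt => /orP[/eqP<-|Nn]; first by rewrite subrr vge0.
by apply: (@vge_trans (u n)); [exact: hN|exact: IH].
Qed.

(* Subrings in which Cauchy sequences converge; an algebraic closure of a local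
   field is not complete, and limits are taken in suitable subrings. *)
Record csub := CSub {
  csort :> E -> Prop;
  csub1 : csort 1;
  csubB : forall x y, csort x -> csort y -> csort (x - y);
  csubM : forall x y, csort x -> csort y -> csort (x * y);
  csub_lim : forall u, (forall n, csort (u n)) -> vcauchy v u ->
    exists2 l, csort l & vcvg v u l
}.

Variable S : csub.

Lemma csub0 : S 0.
Proof. by rewrite -(subrr 1); apply: csubB; exact: csub1. Qed.

Lemma csubN x : S x -> S (- x).
Proof. by move=> h; rewrite -(sub0r x); apply: csubB => //; exact: csub0. Qed.

Lemma csubD x y : S x -> S y -> S (x + y).
Proof. by move=> hx hy; rewrite -(opprK y); apply: csubB => //; exact: csubN. Qed.

Lemma csub_sum (I : Type) (r : seq I) (P : pred I) (F : I -> E) :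
  (forall i, P i -> S (F i)) -> S (\sum_(i <- r | P i) F i).
Proof.
by move=> h; elim/big_rec: _ => [|i x Pi hx]; [exact: csub0|apply: csubD => //; exact: h].
Qed.

Lemma csubX x n : S x -> S (x ^+ n).
Proof.
by move=> h; elim: n => [|n IH]; [exact: csub1|rewrite exprS; exact: csubM].
Qed.

Lemma csub_vlim u : (forall n, S (u n)) -> vcauchy v u ->
  S (vlim v u) /\ vcvg v u (vlim v u).
Proof.
by move=> h /(csub_lim h)[l Sl hl]; rewrite (vlimE hl).
Qed.

End Valuation.

Section Sums.
Variables (E : fieldType) (v : valuation E).
Implicit Types (x y : int -> E) (c : rat).

Definition summable x :=
  forall c, exists N : nat, forall i : int, (N <= `|i|)%N -> vge v (x i) c.

Lemma lpartialS x N :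
  lpartial x N.+1 = lpartial x N + (x (- N.+1%:Z) + x N.+1%:Z).
Proof.
rewrite /lpartial doubleS big_ord_recr big_ord_recl /= -addrA addrCA.
congr (_ + _); last by congr (x _ + x _); lia.
by apply: eq_bigr => i _; congr x; rewrite /bump /=; lia.
Qed.

Lemma lpartial_summable x : summable x -> vcauchy v (lpartial x).
Proof.
move=> h; apply: vcauchyS => c; have [N hN] := h c.
exists N => n Nn; rewrite lpartialS addrC addKr.
by apply: vgeD; apply: hN; lia.
Qed.

Lemma lsum_cvg (S : csub v) x : (forall i, S (x i)) -> summable x ->
  S (lsum v x) /\ vcvg v (lpartial x) (lsum v x).
Proof.
move=> hS h; apply: csub_vlim; last exact: lpartial_summable.
by move=> n; apply: csub_sum => i _; exact: hS.
Qed.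

(** Limits of doubly infinite sums are compared with finite sums through this estimate: modulo
    valuation c only a box of indices counts, and it need not be centred at 0. *)
Lemma lpartial_box x c (A : int) (B N : nat) :
  (forall i : int, i < A \/ A + B%:Z <= i -> vge v (x i) c) ->
  - N%:Z <= A -> A + B%:Z <= N%:Z + 1 ->
  vge v (lpartial x N - \sum_(i < B) x (A + i%:Z)) c.
Proof.
move=> h hA hB; rewrite /lpartial.
have [a ea] : exists a : nat, A = a%:Z - N%:Z by exists (absz (A + N%:Z)); lia.
rewrite -(big_mkord xpredT (fun i => x (i%:Z - N%:Z))).
rewrite (@big_cat_nat _ _ _ a) ?leq0n //=; last by lia.
rewrite (@big_cat_nat _ _ _ (a + B) a) ?leq_addr //=; last by lia.
have -> : \sum_(a <= i < a + B) x (i%:Z - N%:Z) = \sum_(i < B) x (A + i%:Z).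
  rewrite -{1}(add0n a) big_addn addKn big_mkord.
  by apply: eq_bigr => i _; congr x; lia.
rewrite addrCA [X in vge _ X]addrC addKr big_mkord; apply: vgeD.
  by apply: vge_sum => i _; apply: h; left; have := ltn_ord i; lia.
rewrite big_nat; apply: vge_sum => i /andP[i1 i2].
by apply: h; right; lia.
Qed.

Lemma lcvg_vge x l c : vcvg v (lpartial x) l -> (forall i, vge v (x i) c) -> vge v l c.
Proof.
by move=> h hx; apply: (vcvg_vge (N := 0) h) => n _; apply: vge_sum.
Qed.

Lemma lcvg_box x l c (A : int) (B : nat) : vcvg v (lpartial x) l ->
  (forall i : int, i < A \/ A + B%:Z <= i -> vge v (x i) c) ->
  vge v (l - \sum_(i < B) x (A + i%:Z)) c.
Proof.
move=> h hx.
apply: (@vcvg_vge _ _ (fun n => lpartial x n - \sum_(i < B) x (A + i%:Z)) _ _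
         (`|A| + B)%N).
  by apply: vcvgB => //; exact: vcvg_cst.
by move=> n hn; apply: lpartial_box => //; lia.
Qed.

Lemma lcvg_fin x l (A : int) (B : nat) : vcvg v (lpartial x) l ->
  (forall i : int, i < A \/ A + B%:Z <= i -> x i = 0) ->
  l = \sum_(i < B) x (A + i%:Z).
Proof.
move=> h hx; apply: (@eq_vge _ v) => c; apply: lcvg_box => // i /hx ->.
exact: vge0.
Qed.

Lemma lcvg_finite x (A : int) (B : nat) :
  (forall i : int, i < A \/ A + B%:Z <= i -> x i = 0) ->
  vcvg v (lpartial x) (\sum_(i < B) x (A + i%:Z)).
Proof.
move=> hx c; exists (`|A| + B)%N => n hn; apply: lpartial_box => //; try lia.
by move=> i /hx ->; exact: vge0.
Qed.

End Sums.

(** * The ring of Laurent series *)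

Section LaurentMul.
Variables (E : fieldType) (v : valuation E).
Implicit Types (f g h p r : laurent E) (c : rat).

(** A relation rather than an operation, since over a field that is not complete the product of two
    series need not exist. *)
Definition ismul f g p :=
  forall m, vcvg v (lpartial (fun i => f i * g (m - i))) (p m).

Definition ltail f (N : nat) c := forall i : int, i < - N%:Z -> vge v (f i) c.

(* The coefficients of T^(-N), ..., T^(B-N-1), shifted by T^N. *)
Definition ltrunc (N B : nat) f : {poly E} := \poly_(i < B) f (i%:Z - N%:Z).

Lemma ltail_le f N N' c : (N <= N')%N -> ltail f N c -> ltail f N' c.
Proof. by move=> h hf i hi; apply: hf; lia. Qed.

Lemma in_R_tail f c : in_R v f -> exists N, ltail f N c.
Proof.
move=> [_ /(_ c)[N hN]]; exists N => i hi.
by have := hN (absz i); rewrite subr0 (_ : - (absz i)%:Z = i) => [|]; [apply; lia|lia].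
Qed.

Lemma in_R_intro f : (forall m, vint v (f m)) -> (forall c, exists N, ltail f N c) ->
  in_R v f.
Proof.
move=> h1 h2; split => // c; have [N hN] := h2 c; exists N.+1 => n hn.
by rewrite subr0; apply: hN; lia.
Qed.

(** Modulo valuation c only finitely many terms of the product remain, and they form a coefficient
    of a product of two polynomials. Commutativity and associativity of the product are inherited
    from polynomials in this way. *)
Lemma mul_partial f g c (N N' k B n : nat) :
  (forall i, vint v (f i)) -> (forall i, vint v (g i)) ->
  ltail f N c -> ltail g N' c -> (k < B)%N -> (N + N' + k <= n)%N ->
  vge v (lpartial (fun i => f i * g (k%:Z - (N + N')%:Z - i)) n -
         (ltrunc N B f * ltrunc N' B g)`_k) c.
Proof.
move=> hf hg tf tg kB hn.
have -> : (ltrunc N B f * ltrunc N' B g)`_k =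
    \sum_(i < k.+1) f (- N%:Z + i%:Z) * g (k%:Z - (N + N')%:Z - (- N%:Z + i%:Z)).
  rewrite coefM; apply: eq_bigr => i _; rewrite !coef_poly.
  rewrite !ifT; [|have := ltn_ord i; lia..].
  by congr (f _ * g _); have := ltn_ord i; lia.
apply: (@lpartial_box _ _ (fun i => f i * g (k%:Z - (N + N')%:Z - i)));
  last by lia.
  move=> i [hi|hi]; first by apply: vgeMr => //; exact: tf.
  by apply: vgeMl => //; apply: tg; lia.
lia.
Qed.

Lemma mul_approx f g p c (N N' k B : nat) :
  (forall i, vint v (f i)) -> (forall i, vint v (g i)) ->
  ltail f N c -> ltail g N' c -> ismul f g p -> (k < B)%N ->
  vge v (p (k%:Z - (N + N')%:Z) - (ltrunc N B f * ltrunc N' B g)`_k) c.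
Proof.
move=> hf hg tf tg hp kB.
apply: (vcvg_vge (N := (N + N' + k)%N)); first exact: (vcvgB (hp _) (vcvg_cst v _)).
by move=> n hn; exact: mul_partial.
Qed.

Lemma mul_tail f g p c (N N' : nat) :
  (forall i, vint v (f i)) -> (forall i, vint v (g i)) ->
  ltail f N c -> ltail g N' c -> ismul f g p -> ltail p (N + N') c.
Proof.
move=> hf hg tf tg hp m hm; apply: (lcvg_vge (hp m)) => i.
have [hi|hi] := ltP i (- N%:Z); first by apply: vgeMr => //; exact: tf.
by apply: vgeMl => //; apply: tg; lia.
Qed.

Lemma mul_vge f g p c d : (forall i, vge v (f i) c) -> (forall i, vge v (g i) d) ->
  ismul f g p -> forall i, vge v (p i) (c + d).
Proof.
by move=> hf hg hp i; apply: (lcvg_vge (hp i)) => j; exact: vgeM.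
Qed.

Lemma mul_in_R f g p : in_R v f -> in_R v g -> ismul f g p -> in_R v p.
Proof.
move=> hf hg hp; apply: in_R_intro.
  by rewrite /vint -[0]addr0; apply: (mul_vge hf.1 hg.1).
move=> c; have [N tf] := in_R_tail c hf; have [N' tg] := in_R_tail c hg.
by exists (N + N')%N; apply: (mul_tail hf.1 hg.1 tf tg hp).
Qed.

Lemma ismulC f g p : in_R v f -> in_R v g -> ismul f g p -> ismul g f p.
Proof.
move=> hf hg hp m c; have [N0 tf] := in_R_tail c hf; have [N' tg] := in_R_tail c hg.
(* Enlarging the bound by |m| makes m + N + N' a natural number k. *)
pose N := (N0 + absz m)%N.
have tf' : ltail f N c by apply: ltail_le tf; rewrite leq_addr.
have [k ek] : exists k : nat, m = k%:Z - (N + N')%:Z.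
  by exists (absz (m + (N + N')%:Z)); lia.
have h := mul_approx hf.1 hg.1 tf' tg hp (ltnSn k).
exists (N + N' + k)%N => n hn; rewrite ek.
rewrite vge_subC; apply: (vge_trans h); rewrite vge_subC mulrC addnC.
by apply: (mul_partial hg.1 hf.1 tg tf' (ltnSn k)); lia.
Qed.

Lemma ismul_assoc f g h p r x y : in_R v f -> in_R v g -> in_R v h ->
  ismul f g p -> ismul g h r -> ismul p h x -> ismul f r y -> x =1 y.
Proof.
move=> hf hg hh hp hr hx hy m; apply: (@eq_vge _ v) => c.
have hp' := mul_in_R hf hg hp; have hr' := mul_in_R hg hh hr.
have [Nf tf] := in_R_tail c hf; have [Ng tg] := in_R_tail c hg.
have [Nh th] := in_R_tail c hh.
pose N := (Nf + Ng + Nh + absz m)%N.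
have {}tf : ltail f N c by apply: ltail_le tf; rewrite /N; lia.
have {}tg : ltail g N c by apply: ltail_le tg; rewrite /N; lia.
have {}th : ltail h N c by apply: ltail_le th; rewrite /N; lia.
have tp := mul_tail hf.1 hg.1 tf tg hp; have tr := mul_tail hg.1 hh.1 tg th hr.
have [k ek] : exists k : nat, m = k%:Z - (N + N + N)%:Z.
  by exists (absz (m + (N + N + N)%:Z)); lia.
have hx' := mul_approx hp'.1 hh.1 tp th hx (ltnSn k).
have hy' := mul_approx hf.1 hr'.1 tf tr hy (ltnSn k).
have tint n f' : in_R v f' -> forall i, vint v (ltrunc n k.+1 f')`_i.
  by move=> hf' i; rewrite coef_poly; case: ifP => _; [exact: hf'.1|exact: vge0].
set X := (ltrunc N k.+1 f * ltrunc N k.+1 g * ltrunc N k.+1 h)`_k.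
apply: (@vge_trans _ _ X).
  rewrite ek; apply: (vge_trans hx').
  rewrite -coefB -mulrBl coefM; apply: vge_sum => i _; apply: vgeMr; last exact: tint.
  rewrite coefB [X in X - _]coef_poly ltn_ord.
  by apply: (mul_approx hf.1 hg.1 tf tg hp).
rewrite vge_subC ek -addnA; apply: (vge_trans hy').
rewrite /X -mulrA -coefB -mulrBr coefM; apply: vge_sum => i _; apply: vgeMl; first exact: tint.
rewrite coefB [X in X - _]coef_poly ifT; last by lia.
by apply: (mul_approx hg.1 hh.1 tg th hr); lia.
Qed.

Lemma in_R_lmono (k : int) : in_R v (lmono E k).
Proof.
apply: in_R_intro => [m|c]; first by rewrite /lmono; exact: vint_nat.
by exists (absz k).+1 => i hi; rewrite /lmono (_ : (i == k) = false) ?vge0 //; lia.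
Qed.

Lemma ismul_lmono (k : int) f : ismul (lmono E k) f (fun m => f (m - k)).
Proof.
move=> m.
have := @lcvg_finite _ v (fun i => lmono E k i * f (m - i)) k 1.
rewrite big_ord_recr big_ord0 /= add0r addr0 /lmono eqxx mul1r; apply.
by move=> i hi; rewrite (_ : (i == k) = false) ?mul0r //; lia.
Qed.

Lemma ismulD f g g' p p' : ismul f g p -> ismul f g' p' ->
  ismul f (fun m => g m + g' m) (fun m => p m + p' m).
Proof.
move=> h h' m; apply: (eq_vcvg _ (vcvgD (h m) (h' m))) => n.
by rewrite /lpartial -big_split; apply: eq_bigr => i _; rewrite mulrDr.
Qed.

Lemma in_RB f g : in_R v f -> in_R v g -> in_R v (fun m => f m - g m).
Proof.
move=> hf hg; apply: in_R_intro => [m|c].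
  by apply: vgeB; [exact: hf.1|exact: hg.1].
have [N tf] := in_R_tail c hf; have [N' tg] := in_R_tail c hg.
by exists (maxn N N') => i hi; apply: vgeB; [apply: tf|apply: tg]; lia.
Qed.

Lemma ismul_inv_unique f g g' : in_R v f -> in_R v g -> in_R v g' ->
  ismul f g (lmono E 0) -> ismul f g' (lmono E 0) -> g =1 g'.
Proof.
move=> hf hg hg' h h' m.
have hC := ismulC hf hg h.
have e := ismul_lmono 0 g'.
have := @ismul_assoc g f g' _ _ _ _ hg hf hg' hC h' e
  (ismulC (in_R_lmono 0) hg (ismul_lmono 0 g)) m.
by rewrite subr0.
Qed.

Lemma linvE f g : in_R v f -> in_R v g -> ismul f g (lmono E 0) -> linv v f =1 g.
Proof.
move=> hf hg h; rewrite /linv; case: xgetP => [y -> [hy h']|/(_ g)[]//].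
exact: (ismul_inv_unique hf).
Qed.

End LaurentMul.

Section LaurentRing.
Variables (E : fieldType) (v : valuation E) (S : csub v).

(** Coefficients in [S] make all products converge, so these series form a commutative ring, to
    which [ring] and the lemmas on powers apply. *)
Record rlaur := RLaur {
  rl :> int -> E;
  rl_R : in_R v rl;
  rl_S : forall m, S (rl m)
}.

Implicit Types f g h : rlaur.

Lemma rlaurP f g : rl f =1 rl g -> f = g.
Proof.
case: f => f f1 f2; case: g => g g1 g2 /= /funext e; case: _ / e in g1 g2 *.
by congr RLaur; exact: Prop_irrelevance.
Qed.

HB.instance Definition _ := gen_eqMixin rlaur.
HB.instance Definition _ := gen_choiceMixin rlaur.

Lemma mul_summable f g m : summable v (fun i => f i * g (m - i)).
Proof.
move=> c; have [N tf] := in_R_tail c (rl_R f); have [N' tg] := in_R_tail c (rl_R g).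
exists (N + N' + absz m).+1 => i hi.
have [h|h] := ltP i 0; first by apply: vgeMr; [apply: tf; lia|exact: (rl_R g).1].
by apply: vgeMl; [exact: (rl_R f).1|apply: tg; lia].
Qed.

Lemma lmul_cvg f g : (forall m, S (lmul v f g m)) /\ ismul v f g (lmul v f g).
Proof.
suff H m : S (lmul v f g m) /\ vcvg v (lpartial (fun i => f i * g (m - i))) (lmul v f g m).
  by split=> m; have [] := H m.
apply: lsum_cvg; last exact: mul_summable.
by move=> i; apply: csubM; exact: rl_S.
Qed.

Definition rlmul f g := RLaur (mul_in_R (rl_R f) (rl_R g) (lmul_cvg f g).2) (lmul_cvg f g).1.

Lemma rlmul_ismul f g : ismul v f g (rlmul f g).
Proof. exact: (lmul_cvg f g).2. Qed.

Lemma ismul_rlmul f g h : ismul v f g h -> h = rlmul f g.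
Proof. by move=> e; apply: rlaurP => m; apply: vcvg_unique (e m) (rlmul_ismul f g m). Qed.

Definition rlmono (k : int) : rlaur.
Proof.
apply: (@RLaur (lmono E k)); first exact: in_R_lmono.
by move=> m; rewrite /lmono; case: (_ == _); [exact: csub1|exact: csub0].
Defined.

Definition rlsub f g : rlaur.
Proof.
apply: (@RLaur (fun m => f m - g m)); first exact: in_RB (rl_R f) (rl_R g).
by move=> m; apply: csubB; exact: rl_S.
Defined.

(** Zero is written as 1 - 1, so that it needs no membership proof of its own. *)
Definition rlzero : rlaur := rlsub (rlmono 0) (rlmono 0).
Definition rlopp f := rlsub rlzero f.
Definition rladd f g := rlsub f (rlopp g).

Lemma rladdE f g m : rladd f g m = f m + g m.
Proof. by rewrite /= subrr sub0r opprK. Qed.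

Fact rladdA : associative rladd.
Proof. by move=> f g h; apply: rlaurP => m; rewrite !rladdE addrA. Qed.
Fact rladdC : commutative rladd.
Proof. by move=> f g; apply: rlaurP => m; rewrite !rladdE addrC. Qed.
Fact rladd0 : left_id rlzero rladd.
Proof. by move=> f; apply: rlaurP => m; rewrite rladdE /= subrr add0r. Qed.
Fact rladdN : left_inverse rlzero rlopp rladd.
Proof. by move=> f; apply: rlaurP => m; rewrite rladdE /= subrr sub0r addNr. Qed.

HB.instance Definition _ := GRing.isZmodule.Build rlaur rladdA rladdC rladd0 rladdN.

Fact rlmulC : commutative rlmul.
Proof.
by move=> f g; apply: ismul_rlmul; apply: ismulC; [exact: rl_R..|exact: rlmul_ismul].
Qed.
Fact rlmulA : associative rlmul.
Proof.
move=> f g h; apply: rlaurP => m; apply/esym.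
by apply: (@ismul_assoc _ v f g h _ _ _ _ (rl_R f) (rl_R g) (rl_R h));
  exact: rlmul_ismul.
Qed.
Fact rlmul1 : left_id (rlmono 0) rlmul.
Proof.
move=> f; apply/esym/ismul_rlmul => m; have := @ismul_lmono _ v 0 f m.
by rewrite subr0.
Qed.
Fact rlmulD : left_distributive rlmul rladd.
Proof.
move=> f g h; rewrite rlmulC (rlmulC f) (rlmulC g).
apply/esym/ismul_rlmul => m; rewrite rladdE.
have := ismulD (rlmul_ismul h f) (rlmul_ismul h g) m; apply: eq_vcvg => n.
by apply: eq_bigr => i _; rewrite rladdE.
Qed.
Fact rl1_neq0 : rlmono 0 != rlzero.
Proof.
apply/eqP => /(congr1 (fun f : rlaur => f 0)) /= /eqP.
by rewrite subrr /lmono eqxx oner_eq0.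
Qed.

HB.instance Definition _ := GRing.Zmodule_isComNzRing.Build rlaur
  rlmulA rlmulC rlmul1 rlmulD rl1_neq0.

Lemma rlD f g m : (f + g) m = f m + g m.
Proof. exact: rladdE. Qed.

Lemma rl0 m : (0 : rlaur) m = 0.
Proof. by rewrite /= subrr. Qed.

Lemma rlN f m : (- f) m = - f m.
Proof. by rewrite /= subrr sub0r. Qed.

Lemma rlB f g m : (f - g) m = f m - g m.
Proof. by rewrite rlD rlN. Qed.

Lemma rl1 m : (1 : rlaur) m = (m == 0)%:R.
Proof. by []. Qed.

Lemma rlM f g : ismul v f g (f * g).
Proof. exact: rlmul_ismul. Qed.

Lemma lpow_pos f (n : nat) : lpow v f n = (f ^+ n : rlaur).
Proof.
rewrite /lpow; elim: n => [//|n IH]; rewrite iterS IH exprS.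
by apply: funext.
Qed.

Lemma linv_rl f g : f * g = 1 -> linv v f = g.
Proof.
move=> e; apply/funext/(linvE (rl_R f) (rl_R g)) => m.
by have := rlM f g m; rewrite e.
Qed.

Lemma lpow_neg f g (n : nat) : f * g = 1 -> lpow v f (Negz n) = (g ^+ n.+1 : rlaur).
Proof. by move=> /linv_rl e; rewrite -lpow_pos /lpow e. Qed.

End LaurentRing.

(** * Gauss valuations, weights and orders of Laurent series *)

Section LaurentBounds.
Variables (E : fieldType) (v : valuation E) (S : csub v).
Implicit Types (f g x : rlaur S) (c d : rat).

Definition lge f c := forall m, vge v (f m) c.

(* Gauss valuation at least [c] when T has valuation [w]. *)
Definition lw (w : rat) f c := forall m, vge v (f m) (c - m%:~R * w).

Definition lord f (N : int) := forall m, m < N -> f m = 0.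

Lemma rl_int f : lge f 0.
Proof. exact: (rl_R f).1. Qed.

Lemma lgeD f g c : lge f c -> lge g c -> lge (f + g) c.
Proof. by move=> hf hg m; rewrite rlD vgeD. Qed.

Lemma lgeM f g c d : lge f c -> lge g d -> lge (f * g) (c + d).
Proof. by move=> hf hg; exact: (mul_vge hf hg (rlM f g)). Qed.

Lemma lgeMr f g c : lge f c -> lge (f * g) c.
Proof. by move=> hf; rewrite -(addr0 c); apply: lgeM => //; exact: rl_int. Qed.

Lemma lgeMl f g c : lge f c -> lge (g * f) c.
Proof. by rewrite mulrC; exact: lgeMr. Qed.

Lemma rl_eq0 f : (forall n : nat, lge f n%:R) -> f = 0.
Proof.
move=> h; apply: rlaurP => m; rewrite rl0; apply: (@vge_inf _ v) => c.
apply: (vge_le _ (h (Num.bound `|c|) m)).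
by apply/ltW/(le_lt_trans (ler_norm c)); exact: archi_boundP.
Qed.

Lemma lwM w f g c d : lw w f c -> lw w g d -> lw w (f * g) (c + d).
Proof.
move=> hf hg m; apply: (lcvg_vge (rlM f g m)) => i.
have -> : c + d - m%:~R * w = (c - i%:~R * w) + (d - (m - i)%:~R * w).
  by rewrite rmorphB /=; ring.
exact: vgeM.
Qed.

Lemma lw1 w : lw w 1 0.
Proof.
move=> m; rewrite rl1; case: eqP => [->|_]; last exact: vge0.
by rewrite mul0r subrr; exact: vint1.
Qed.

Lemma lwX w f c n : lw w f c -> lw w (f ^+ n) (n%:R * c).
Proof.
move=> h; elim: n => [|n IH]; first by rewrite mul0r expr0; exact: lw1.
by rewrite exprS -nat1r mulrDl mul1r; exact: lwM.
Qed.

Lemma lordM f g a b : lord f a -> lord g b -> lord (f * g) (a + b).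
Proof.
move=> hf hg m hm; apply: (@vge_inf _ v) => c.
apply: (lcvg_vge (rlM f g m)) => i.
have [hi|hi] := ltP i a; first by rewrite hf // mul0r vge0.
by rewrite hg ?mulr0 ?vge0 //; lia.
Qed.

Lemma lord1 : lord 1 0.
Proof. by move=> m hm; rewrite rl1 (_ : (m == 0) = false) //; lia. Qed.

Lemma lordX f a n : lord f a -> lord (f ^+ n) (a *+ n).
Proof.
move=> h; elim: n => [|n IH]; first by rewrite mulr0n expr0; exact: lord1.
by rewrite exprS mulrS; exact: lordM.
Qed.

Lemma coef_rlM f g (m : nat) : lord f 0 -> lord g 0 ->
  (f * g) m = \sum_(i < m.+1) f i%:Z * g (m%:Z - i%:Z).
Proof.
move=> hf hg; rewrite (@lcvg_fin _ v _ _ 0 m.+1 (rlM f g m)).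
  by apply: eq_bigr => i _; rewrite add0r.
move=> i [hi|hi]; first by rewrite hf ?mul0r.
by rewrite hg ?mulr0 //; lia.
Qed.

(** A factor without negative powers moves coefficients only upwards, so the coefficient at j does
    not see f beyond j. This matters because powers of u become small only on indices bounded
    above. *)
Lemma rlM_vge x f (j : int) c : lord x 0 ->
  (forall m, m <= j -> vge v (f m) c) -> vge v ((x * f) j) c.
Proof.
move=> hx hf; apply: (lcvg_vge (rlM x f j)) => i.
have [hi|hi] := ltP i 0; first by rewrite hx // mul0r vge0.
apply: vgeMl; first exact: rl_int.
by apply: hf; lia.
Qed.

Lemma ltailX f N c n : 0 <= c -> ltail v f N c -> ltail v (f ^+ n : rlaur S) (N * n) c.
Proof.
move=> c0 h; elim: n => [|n IH]; first by move=> i hi; rewrite lord1 ?vge0 //; lia.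
rewrite exprS mulnS.
by apply: (mul_tail (@rl_int _) (@rl_int _) h IH (rlM _ _)).
Qed.

Lemma rlmonoM (k l : int) : rlmono S k * rlmono S l = rlmono S (k + l).
Proof.
apply/esym/ismul_rlmul => m; have := @ismul_lmono _ v k (rlmono S l) m.
by rewrite /= /lmono subr_eq addrC.
Qed.

Lemma rlmonoX (k : int) n : rlmono S k ^+ n = rlmono S (k *+ n).
Proof.
elim: n => [|n IH]; first by rewrite mulr0n.
by rewrite exprS mulrS IH rlmonoM.
Qed.

Lemma lmonoM_coef (k : int) f m : (rlmono S k * f) m = f (m - k).
Proof.
by apply: vcvg_unique (rlM (rlmono S k) f m) _; exact: ismul_lmono.
Qed.

Definition pw f g (k : int) : rlaur S :=
  match k with Posz n => f ^+ n | Negz n => g ^+ n.+1 end.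

Lemma lpowE f g k : f * g = 1 -> lpow v f k = pw f g k.
Proof.
by move=> e; case: k => n; [exact: lpow_pos|exact: (lpow_neg _ e)].
Qed.

Lemma pwD f g (n : nat) k : f * g = 1 -> f ^+ n * pw f g k = pw f g (n%:Z + k).
Proof.
move=> e; elim: n k => [|n IH] k; first by rewrite mul1r add0r.
rewrite exprSr -mulrA.
have -> : f * pw f g k = pw f g (1 + k); last by rewrite IH; congr pw; lia.
case: k => [k|[|k]]; first by rewrite -exprS.
  by rewrite /= expr1 e.
rewrite (_ : 1 + Negz k.+1 = Negz k); last by lia.
by rewrite /= exprS mulrA e mul1r.
Qed.

Lemma pw_rlmono (r k : int) : pw (rlmono S r) (rlmono S (- r)) k = rlmono S (r * k).
Proof.
case: k => n /=; rewrite rlmonoX; congr rlmono.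
  by rewrite -mulr_natr natz.
by rewrite NegzE -mulr_natr mulNr mulrN natz.
Qed.

Lemma lgeX_sub f g n c : lge (f - g) c -> lge (f ^+ n - g ^+ n) c.
Proof. by move=> h; rewrite subrXX; exact: lgeMr. Qed.

Lemma pw_sub f f' g g' k c : f * f' = 1 -> g * g' = 1 ->
  lge (f - g) c -> lge (pw f f' k - pw g g' k) c.
Proof.
move=> ef eg h; case: k => n; first exact: lgeX_sub.
apply: lgeX_sub.
have -> : f' - g' = (f - g) * (- f' * g').
  have -> : f' - g' = f' * (g * g') - g' * (f * f') by rewrite ef eg !mulr1.
  ring.
exact: lgeMr.
Qed.

Definition rlconst a (ha : vint v a) (hS : S a) : rlaur S.
Proof.
apply: (@RLaur _ _ _ (fun m => a * lmono E 0 m)).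
  apply: in_R_intro => [m|c].
    by apply: vgeMl => //; exact: (in_R_lmono v 0).1.
  exists 0%N => i hi; rewrite /lmono (_ : (i == 0) = false) ?mulr0 ?vge0 //; lia.
by move=> m; apply: csubM => //; exact: (rl_S (1 : rlaur S)).
Defined.

Lemma rlconstM a (ha : vint v a) (hS : S a) f m : (rlconst ha hS * f) m = a * f m.
Proof.
apply: vcvg_unique (rlM _ f m) _.
have := vcvgMl a (@ismul_lmono _ v 0 f m); rewrite subr0; apply: eq_vcvg => n.
by rewrite /lpartial mulr_sumr; apply: eq_bigr => i _; rewrite /= mulrA.
Qed.

End LaurentBounds.

(** * Substitution into a Laurent series *)

Section Composition.
Variables (E : fieldType) (v : valuation E) (S : csub v).
Variables (u u' : rlaur S) (w c0 : rat).
Hypotheses (uu' : u * u' = 1) (w_ge0 : 0 <= w) (c0_gt0 : 0 < c0).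
Hypotheses (lw_u : lw w u c0) (lord_u : lord u 0).
Implicit Types (g x : rlaur S).

Lemma pw_ord (n : nat) : lord (u ^+ n) 0.
Proof. by have := lordX (n := n) lord_u; rewrite mul0rn. Qed.

(** The coefficient of T^m in u^k has valuation at least k c0 - m w, which tends to infinity with k,
    uniformly for m <= j. This gives convergence of g(u) on the side of positive k; for negative k
    the coefficients of g tend to 0. *)
Lemma pw_large (c : rat) (j : int) : exists N : nat, forall (k : int) m,
  N%:Z <= k -> m <= j -> vge v (pw u u' k m) c.
Proof.
pose b := (c + j%:~R * w) / c0; exists (Num.bound `|b|) => -[n|n] m hk hm //.
apply: vge_le (lwX n lw_u m).
have : b < n%:R :> rat.
  apply: (le_lt_trans (ler_norm b)); apply: (lt_le_trans (archi_boundP _)) => //.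
  by rewrite ler_nat.
rewrite /b ltr_pdivrMr // => hb.
have : m%:~R * w <= j%:~R * w by rewrite ler_wpM2r // ler_int.
lra.
Qed.

Lemma lcomp_summable g m : summable v (fun k => g k * pw u u' k m).
Proof.
move=> c; have [N tg] := in_R_tail c (rl_R g); have [N' hN'] := pw_large c m.
exists (N + N').+1 => -[k|k] hk.
  by apply: vgeMl; [exact: rl_int|apply: hN' => //; lia].
by apply: vgeMr; [apply: tg; lia|exact: rl_int].
Qed.

Lemma lcomp_cvg g m : S (lcomp v g u m) /\
  vcvg v (lpartial (fun k => g k * pw u u' k m)) (lcomp v g u m).
Proof.
rewrite /lcomp (_ : (fun k => _) = (fun k => g k * pw u u' k m)).
  apply: lsum_cvg; last exact: lcomp_summable.
  by move=> k; apply: csubM; exact: rl_S.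
by apply/funext => k; rewrite (lpowE _ uu').
Qed.

Lemma lcomp_vge g c m : lge g c -> vge v (lcomp v g u m) c.
Proof.
move=> h; apply: (lcvg_vge (lcomp_cvg g m).2) => k.
by apply: vgeMr => //; exact: rl_int.
Qed.

Lemma lcomp_in_R g : in_R v (lcomp v g u).
Proof.
apply: in_R_intro => [m|c']; first by apply: lcomp_vge; exact: rl_int.
pose c := Num.max c' 0; have [K tg] := in_R_tail c (rl_R g).
have [N tu] := in_R_tail c (rl_R u').
(* Modulo c only the powers u'^k with k <= K count, and u'^k starts at -Nk. *)
exists (N * K)%N => m hm; apply: (@vge_le _ _ c); first by rewrite le_max lexx.
apply: (lcvg_vge (lcomp_cvg g m).2) => -[k|k].
  by rewrite pw_ord ?mulr0 ?vge0 //; lia.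
have [hk|hk] := ltP (Negz k) (- K%:Z); first by apply: vgeMr; [exact: tg|exact: rl_int].
apply: vgeMl; first exact: rl_int.
apply: (ltailX (n := k.+1) _ tu); first by rewrite le_max lexx orbT.
nia.
Qed.

Definition rlcomp g := RLaur (lcomp_in_R g) (fun m => (lcomp_cvg g m).1).

Lemma rlcomp_cvg g m : vcvg v (lpartial (fun k => g k * pw u u' k m)) (rlcomp g m).
Proof. exact: (lcomp_cvg g m).2. Qed.

(** If u is close to T^r, then g(u) is close to g(T^r), whose coefficient at rk is g_k. It serves
    with r = 1 for a +_F T and with r = q for phi. *)
Lemma rlcomp_sub g (r k : int) b c : r != 0 -> lge g b -> lge (u - rlmono S r) c ->
  vge v (rlcomp g (r * k) - g k) (b + c).
Proof.
move=> r0 hg hu.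
have h1 := rlcomp_cvg g (r * k).
have h2 := @lcvg_finite _ v (fun i => g i * rlmono S (r * i) (r * k)) k 1.
move: h2; rewrite big_ord_recr big_ord0 /= add0r addr0 /lmono eqxx mulr1 => h2.
have h3 := vcvgB h1 (h2 _).
apply: (@lcvg_vge _ _ (fun i => g i * (pw u u' i - pw (rlmono S r) (rlmono S (- r)) i) (r * k))).
  apply: (eq_vcvg _ (h3 _)) => [n|i hi].
    rewrite -sumrB; apply: eq_bigr => i _; by rewrite pw_rlmono rlB [RHS]mulrBr.
  have [e|_] := eqVneq (r * k) (r * i); last by rewrite mulr0.
  by move: hi; rewrite (mulfI r0 e); lia.
move=> i; apply: vgeM => //; apply: pw_sub => //.
by rewrite rlmonoM subrr.
Qed.

(** Multiplication by x can be carried out term by term: the series g(u) converges uniformly on the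
    indices up to j, and no others enter the coefficient at j of the product. *)
Lemma rlcomp_cont g x j : lord x 0 ->
  vcvg v (lpartial (fun k => g k * (x * pw u u' k) j)) ((x * rlcomp g) j).
Proof.
move=> hx c; have [N tg] := in_R_tail c (rl_R g); have [N' hN'] := pw_large c j.
exists (N + N').+1 => n hn; rewrite vge_subC.
pose R := rlcomp g - \sum_(i < n.*2.+1)
   rlconst (rl_int g (i%:Z - n%:Z)) (rl_S g _) * pw u u' (i%:Z - n%:Z).
have coef_sum (I : Type) (r : seq I) (F : I -> rlaur S) m :
    (\sum_(i <- r) F i) m = \sum_(i <- r) F i m.
  elim: r => [|i r IH]; first by rewrite !big_nil rl0.
  by rewrite !big_cons rlD IH.
have -> : (x * rlcomp g) j - lpartial (fun k => g k * (x * pw u u' k) j) n = (x * R) j.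
  rewrite /R mulrBr rlB mulr_sumr coef_sum; congr (_ - _).
  by apply: eq_bigr => i _; rewrite mulrCA rlconstM.
apply: rlM_vge => // m hm; rewrite /R rlB coef_sum.
rewrite (eq_bigr (fun i : 'I_(n.*2.+1) => g (i%:Z - n%:Z) * pw u u' (i%:Z - n%:Z) m)); last first.
  by move=> i _; rewrite rlconstM.
have := @lcvg_box _ v _ _ c (- n%:Z) n.*2.+1 (rlcomp_cvg g m).
under eq_bigr do rewrite addrC.
apply=> -[k|k] hk.
  by apply: vgeMl; [exact: rl_int|apply: hN' => //; lia].
by apply: vgeMr; [apply: tg; lia|exact: rl_int].
Qed.

End Composition.

(** * Completeness, inverses and Weierstrass preparation *)

Section Completeness.
Variables (E : fieldType) (v : valuation E) (S : csub v).
Implicit Types (f g x y : rlaur S) (c : rat).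

(** The limit is taken coefficientwise. The approximation is uniform in the degree, so the decay of
    the limit towards minus infinity is inherited from a single [Y N]. *)
Lemma rl_complete (Y : nat -> rlaur S) :
  (forall c, exists N, forall n, (N <= n)%N -> lge (Y n.+1 - Y n) c) ->
  exists y, forall c, exists N, forall n, (N <= n)%N -> lge (y - Y n) c.
Proof.
move=> h.
have hC m : vcauchy v (fun n => Y n m).
  apply: vcauchyS => c; have [N hN] := h c; exists N => n /hN /(_ m).
  by rewrite rlB.
pose y0 m := vlim v (fun n => Y n m).
have hy m : S (y0 m) /\ vcvg v (fun n => Y n m) (y0 m).
  by apply: csub_vlim => // n; exact: rl_S.
have close c : exists N, forall n, (N <= n)%N -> forall m, vge v (y0 m - Y n m) c.
  have [N hN] := h c; exists N => n Nn m.
  apply: (@vcvg_vge _ _ (fun k => Y k m - Y n m) _ _ n).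
    by apply: vcvgB; [exact: (hy m).2|exact: vcvg_cst].
  elim=> [|k IH]; first by rewrite leqn0 => /eqP ->; rewrite subrr vge0.
  rewrite leq_eqVlt => /orP[/eqP<-|nk]; first by rewrite subrr vge0.
  apply: (@vge_trans _ _ (Y k m)); last exact: IH.
  by rewrite -rlB; apply: hN; lia.
have y0R : in_R v y0.
  apply: in_R_intro => [m|c].
    by apply: (vcvg_vge (N := 0) (hy m).2) => n _; exact: rl_int.
  have [N hN] := close c; have [N' tY] := in_R_tail c (rl_R (Y N)).
  by exists N' => i hi; apply: (vge_sub (hN N _ i)) => //; exact: tY.
exists (RLaur y0R (fun m => (hy m).1)) => c; have [N hN] := close c.
by exists N => n /hN hn m; rewrite rlB; exact: hn.
Qed.

Lemma lge_le c d f : c <= d -> lge f d -> lge f c.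
Proof. by move=> cd h m; apply: (vge_le cd). Qed.

Lemma lgeN f c : lge f c -> lge (- f) c.
Proof. by move=> h m; rewrite rlN vgeN. Qed.

Lemma lgeX f c n : lge f c -> lge (f ^+ n) (n%:R * c).
Proof.
move=> h; elim: n => [|n IH]; first by rewrite mul0r; exact: rl_int.
by rewrite exprS -nat1r mulrDl mul1r; exact: lgeM.
Qed.

Lemma archi_mul c d : 0 < d -> exists N : nat, forall n, (N <= n)%N -> c <= n%:R * d.
Proof.
move=> d0; exists (Num.bound `|c / d|) => n hn.
rewrite -ler_pdivrMr //; apply/ltW/(le_lt_trans (ler_norm _)).
by apply: (lt_le_trans (archi_boundP _)) => //; rewrite ler_nat.
Qed.

Lemma geometric_inverse x c : 0 < c -> lge x c -> exists y, (1 - x) * y = 1.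
Proof.
move=> c0 hx; pose Y n := \sum_(i < n) x ^+ i.
have hY n : (1 - x) * Y n = 1 - x ^+ n.
  by rewrite -{2}(expr1n _ n) subrXX; congr (_ * _); apply: eq_bigr => i _; rewrite expr1n mul1r.
have [b|y hy] := @rl_complete Y.
  have [N hN] := archi_mul b c0; exists N => n Nn.
  have -> : Y n.+1 - Y n = x ^+ n by rewrite /Y big_ord_recr addrAC subrr add0r.
  by apply: lge_le (lgeX n hx); exact: hN.
exists y; apply/eqP; rewrite -subr_eq0; apply/eqP/rl_eq0 => k.
have [N1 h1] := hy k%:R; have [N2 h2] := archi_mul k%:R c0.
pose n := maxn N1 N2.
have -> : (1 - x) * y - 1 = (1 - x) * (y - Y n) - x ^+ n.
  by rewrite mulrBr hY; ring.
apply: lgeD; first by apply: lgeMl; apply: h1; rewrite leq_maxl.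
by apply: lgeN; apply: lge_le (lgeX n hx); apply: h2; rewrite leq_maxr.
Qed.

Lemma inverse_near_mono x (r : int) c : 0 < c -> lge (x - rlmono S r) c ->
  exists y, x * y = 1.
Proof.
move=> c0 hx; have [|y hy] := @geometric_inverse (1 - rlmono S (- r) * x) c c0.
  have -> : 1 - rlmono S (- r) * x = - (rlmono S (- r) * (x - rlmono S r)).
    by rewrite mulrBr rlmonoM addNr opprB.
  by apply: lgeN; exact: lgeMl.
exists (rlmono S (- r) * y); rewrite -hy; ring.
Qed.

Definition rlpart (A : pred int) f : rlaur S.
Proof.
apply: (@RLaur _ _ _ (fun m : int => if A m then f m else 0)).
  apply: in_R_intro => [m|c]; first by case: ifP => _; [exact: rl_int|exact: vge0].
  have [N hN] := in_R_tail c (rl_R f); exists N => i hi.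
  by case: ifP => _; [exact: hN|exact: vge0].
by move=> m; case: ifP => _; [exact: rl_S|exact: csub0].
Defined.

Lemma lge_rlpartB A f g c : lge (f - g) c -> lge (rlpart A f - rlpart A g) c.
Proof.
move=> h m; have := h m; rewrite !rlB /=; case: ifP => // _ _.
by rewrite subrr vge0.
Qed.

(* Weierstrass preparation: [x * y] is a monic polynomial of degree [r].  The unit
   [y] is the fixed point of the contraction [step]. *)
Lemma weierstrass x (r : nat) c : 0 < c -> lord x 0 -> lge (x - rlmono S r) c ->
  exists y, [/\ lord y 0, lge (y - 1) c &
    forall m : int, r%:Z <= m -> (x * y) m = (m == r%:Z)%:R].
Proof.
move=> c0 x0 hx; pose e := rlmono S (- r%:Z) * (x - rlmono S r).
have he : lge e c by exact: lgeMl.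
pose pos := rlpart (fun m => 0 <= m); pose step y := 1 - pos (e * y).
have step_sub y z b : lge (y - z) b -> lge (step y - step z) (c + b).
  move=> h; have -> : step y - step z = - (pos (e * y) - pos (e * z)).
    by rewrite /step; ring.
  by apply/lgeN/lge_rlpartB; rewrite -mulrBr; exact: lgeM.
pose Y n := iter n step 1.
have hY n : lge (Y n.+1 - Y n) (n%:R * c).
  elim: n => [|n IH]; first by rewrite mul0r; exact: rl_int.
  by rewrite -nat1r mulrDl mul1r; exact: step_sub.
have [b|y hy] := @rl_complete Y.
  have [N hN] := archi_mul b c0; exists N => n Nn.
  by apply: lge_le (hY n); exact: hN.
have fix_y : y = step y.
  apply/eqP; rewrite -subr_eq0; apply/eqP/rl_eq0 => k.
  have [N h] := hy k%:R.
  have -> : y - step y = (y - Y N.+1) + - (step y - step (Y N)).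
    by rewrite /Y iterS; ring.
  apply: lgeD; first by apply: h.
  by apply/lgeN; apply: lge_le (step_sub _ _ _ (h N _)); rewrite ?lerDr ?ltW.
have y0 : lord y 0.
  move=> m hm; rewrite fix_y rlB lord1 //=.
  by rewrite (_ : (0 <= m) = false) ?subr0 //; lia.
exists y; split=> //.
  move=> m; rewrite {1}fix_y /step addrAC subrr sub0r rlN vgeN /=.
  by case: ifP => _; [apply: lgeMr he m|exact: vge0].
move=> m hm.
(* Here x = T^r (1 + e), and the fixed point equation says that y + e y is 1 plus the part of e y in
   negative degrees. *)
have -> : x * y = rlmono S r * (y + e * y).
  have rs : rlmono S r * rlmono S (- r%:Z) = 1 by rewrite rlmonoM subrr.
  have -> : rlmono S r * (y + e * y) =
      rlmono S r * y + rlmono S r * rlmono S (- r%:Z) * ((x - rlmono S r) * y).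
    by rewrite /e; ring.
  by rewrite rs; ring.
rewrite lmonoM_coef rlD {1}fix_y rlB rl1 /= ifT; last by lia.
by rewrite subrK subr_eq0.
Qed.

End Completeness.

(** * Translation by a point of the formal module *)

Section TruncatedComposition.
Variable R : comNzRingType.

Section Order.
Variable n : nat.
Implicit Types (p q r : {mpoly R[n]}) (d : nat).

(** Membership in the d-th power of the ideal of the variables; [mord d (p - q)] expresses a
    congruence up to total degree d, the form in which identities of power series are transferred to
    polynomials. *)
Definition mord d p := forall m, (mdeg m < d)%N -> p@_m = 0.

Lemma mord0 d : mord d 0.
Proof. by move=> m _; rewrite mcoeff0. Qed.

Lemma mordD d p q : mord d p -> mord d q -> mord d (p + q).
Proof. by move=> hp hq m hm; rewrite mcoeffD hp // hq // addr0. Qed.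

Lemma mordN d p : mord d p -> mord d (- p).
Proof. by move=> hp m hm; rewrite mcoeffN hp // oppr0. Qed.

Lemma mordM d e p q : mord d p -> mord e q -> mord (d + e) (p * q).
Proof.
move=> hp hq m hm; rewrite mcoeffM big1 // => -[k l] /= /eqP em.
have [hk|hk] := ltnP (mdeg k) d; first by rewrite hp // mul0r.
have := congr1 (@mdeg n) em; rewrite mdegD => em'; rewrite hq ?mulr0 //; lia.
Qed.

Lemma mord_le d e p : (d <= e)%N -> mord e p -> mord d p.
Proof. by move=> h hp m hm; apply: hp; exact: leq_trans h. Qed.

Lemma mordMr d p q : mord d p -> mord d (p * q).
Proof. by move=> hp; rewrite -(addn0 d); apply: mordM. Qed.

Lemma mordX p k : mord 1 p -> mord k (p ^+ k).
Proof.
move=> h; elim: k => [//|k IH]; rewrite exprS -add1n; exact: mordM.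
Qed.

Lemma mord_trans d p q r : mord d (p - q) -> mord d (q - r) -> mord d (p - r).
Proof. by move=> h1 h2; rewrite -(subrKA q); exact: mordD. Qed.

Lemma mord_refl d p : mord d (p - p).
Proof. by rewrite subrr; exact: mord0. Qed.

Lemma mord_mul_congr d p p' q q' :
  mord d (p - p') -> mord d (q - q') -> mord d (p * q - p' * q').
Proof.
move=> hp hq; apply: (@mord_trans _ _ (p' * q)); first by rewrite -mulrBl; exact: mordMr.
by rewrite -mulrBr mulrC; exact: mordMr.
Qed.

Lemma mord_exp_congr d p p' k : mord d (p - p') -> mord d (p ^+ k - p' ^+ k).
Proof. by move=> h; rewrite subrXX; exact: mordMr. Qed.

Lemma mcoeff_trunc N (f : mps n R) m :
  (mps_trunc N f)@_m = if (mdeg m < N)%N then f m else 0.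
Proof.
case: ifP => [h|h]; first exact: mcoeff_mpoly.
rewrite raddf_sum big1 //= => k _; rewrite mcoeffZ mcoeffX.
case: eqP => [e|_]; last by rewrite mulr0.
by move: (bmdeg k); rewrite e h.
Qed.

Lemma mord_trunc_congr d N (f : mps n R) p :
  (d <= N)%N -> (forall m, (mdeg m < d)%N -> f m = p@_m) -> mord d (mps_trunc N f - p).
Proof.
move=> dN h m hm; rewrite mcoeffB mcoeff_trunc (leq_trans hm dN) h ?subrr //.
Qed.

End Order.

Section Comp.
Variables k n : nat.
Implicit Types (p : {mpoly R[k]}) (lq lr : k.-tuple {mpoly R[n]}).

Lemma mord_mPo d p lq :
  (forall i, mord 1 (tnth lq i)) -> mord d p -> mord d (p \mPo lq).
Proof.
move=> hq hp; rewrite comp_mpolyE; apply: big_rec => [|m q _ hq']; first exact: mord0.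
apply: mordD => //; have [hm|hm] := ltnP (mdeg m) d.
  by rewrite hp // scale0r; exact: mord0.
rewrite -mul_mpolyC mulrC; apply: mordMr; apply: (mord_le hm).
rewrite mdegE; elim/big_rec2: _ => [//|i a b _ hab].
by apply: mordM => //; exact: mordX.
Qed.

Lemma mord_mPo_congr d p lq lr :
  (forall i, mord d (tnth lq i - tnth lr i)) -> mord d ((p \mPo lq) - (p \mPo lr)).
Proof.
move=> h; rewrite !comp_mpolyE.
elim/big_ind2: _ => [|x y x' y' h1 h2|m _]; first exact: mord_refl.
  by rewrite opprD addrACA; exact: mordD.
rewrite -scalerBr -mul_mpolyC mulrC; apply: mordMr.
elim/big_ind2: _ => [|x y x' y' h1 h2|i _]; first exact: mord_refl.
  exact: mord_mul_congr.
exact: mord_exp_congr.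
Qed.

(** The definition truncates at a level that varies with the coefficient. Without constant terms in
    the g i any higher level gives the same coefficient, so one N can serve for many coefficients at
    once. *)
Lemma mps_compE (f : mps k R) (g : 'I_k -> mps n R) N m :
  (forall i, g i 0%MM = 0) -> (mdeg m < N)%N ->
  mps_comp f g m = (mps_trunc N f \mPo [tuple mps_trunc N (g i) | i < k])@_m.
Proof.
move=> g0 hm; rewrite /mps_comp; set d := (mdeg m).+1.
apply/eqP; rewrite -subr_eq0 -mcoeffB; apply/eqP.
have hd : (mdeg m < d)%N by [].
suff: mord d ((mps_trunc d f \mPo [tuple mps_trunc d (g i) | i < k]) -
    (mps_trunc N f \mPo [tuple mps_trunc N (g i) | i < k])) by apply.
apply: (@mord_trans _ _ _ (mps_trunc d f \mPo [tuple mps_trunc N (g i) | i < k])).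
  apply: mord_mPo_congr => i; rewrite !tnth_mktuple; apply: mord_trunc_congr => // m' hm'.
  by rewrite mcoeff_trunc (leq_trans hm').
rewrite -comp_mpolyB; apply: mord_mPo => [i|].
  rewrite tnth_mktuple => m' hm'; rewrite mcoeff_trunc.
  have -> : m' = 0%MM by apply/eqP; rewrite -mdeg_eq0; lia.
  by rewrite g0 if_same.
apply: mord_trunc_congr => // m' hm'.
by rewrite mcoeff_trunc (leq_trans hm').
Qed.

Lemma mps_comp_mord (f : mps k R) (g : 'I_k -> mps n R) N lq :
  (forall i, g i 0%MM = 0) ->
  (forall i, mord N (mps_trunc N (g i) - tnth lq i)) ->
  mord N (mps_trunc N (mps_comp f g) - (mps_trunc N f \mPo lq)).
Proof.
move=> g0 hg.
apply: (@mord_trans _ _ _ (mps_trunc N f \mPo [tuple mps_trunc N (g i) | i < k])).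
  by apply: mord_trunc_congr => // m hm; exact: mps_compE.
by apply: mord_mPo_congr => i; rewrite tnth_mktuple.
Qed.

End Comp.

Lemma trunc_var n (i : 'I_n) N : (1 < N)%N -> mps_trunc N (mps_var R i) = 'X_i.
Proof.
move=> hN; apply/mpolyP => m; rewrite mcoeff_trunc mcoeffX /mps_var eq_sym.
case: ifP => // h; case: eqP => // e; move: h; rewrite -e mdeg1 hN //.
Qed.

Lemma var0 n (i : 'I_n) : mps_var R i 0%MM = 0.
Proof. by rewrite /mps_var eq_sym mnm1_eq0. Qed.

Lemma mmap_mPo (S : comNzRingType) (g : {rmorphism R -> S}) n k (h : 'I_n -> S)
    (p : {mpoly R[k]}) (lq : k.-tuple {mpoly R[n]}) :
  mmap g h (p \mPo lq) = mmap g (fun i => mmap g h (tnth lq i)) p.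
Proof.
rewrite comp_mpolyEX raddf_sum /mmap; apply: eq_bigr => m _ /=.
rewrite -mul_mpolyC rmorphM /= mmapC comp_mpolyX rmorph_prod /=; congr (_ * _).
by apply: eq_bigr => i _; rewrite rmorphXn.
Qed.

Lemma mmap_trunc (S : comNzRingType) (g : {rmorphism R -> S}) n (h : 'I_n -> S) N f :
  mmap g h (mps_trunc N f) = \sum_(m : 'X_{1..n < N}) g (f m) * mmap1 h m.
Proof.
rewrite raddf_sum; apply: eq_bigr => m _ /=.
by rewrite -mul_mpolyC rmorphM /= mmapC mmapX.
Qed.

Definition mnT (j : nat) : 'X_{1..1} := [multinom j | _ < 1].
Definition mnXY (i j : nat) : 'X_{1..2} :=
  [multinom (if k == ord0 then i else j) | k < 2].

Lemma mnXY_0 i j : mnXY i j ord0 = i.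
Proof. by rewrite mnmE. Qed.

Lemma mnXY_1 i j : mnXY i j (inord 1) = j.
Proof. by rewrite mnmE -val_eqE /= inordK. Qed.

Lemma mdeg_mnT j : mdeg (mnT j) = j.
Proof. by rewrite mdegE big_ord1 mnmE. Qed.

Lemma mdeg_mnXY i j : mdeg (mnXY i j) = (i + j)%N.
Proof. by rewrite mdegE !big_ord_recr big_ord0 /= !mnmE. Qed.

Lemma mnT_eta (m : 'X_{1..1}) : m = mnT (m ord0).
Proof. by apply/mnmP => i; rewrite mnmE (ord1 i). Qed.

Lemma mnXY_eta (m : 'X_{1..2}) : m = mnXY (m ord0) (m (inord 1)).
Proof.
apply/mnmP => i; rewrite mnmE; case: eqP => [-> //|/eqP hi].
by congr (m _); apply: val_inj; rewrite /= inordK //; case: i hi => -[|[|]].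
Qed.

Lemma sum_mnT (S : nmodType) N (G : 'X_{1..1} -> S) :
  \sum_(m : 'X_{1..1 < N}) G m = \sum_(j < N) G (mnT j).
Proof.
have hlt (j : 'I_N) : (mdeg (mnT j) < N)%N by rewrite mdeg_mnT.
rewrite (reindex_onto (fun j : 'I_N => BMultinom (hlt j)) (fun m => insubd (Ordinal (leq_ltn_trans (leq0n _) (bmdeg m))) (bmnm m ord0))).
  apply: eq_bigl => j; apply/eqP/val_inj; rewrite val_insubd /= mnmE.
  by rewrite ltn_ord.
move=> m _; apply/val_inj; rewrite /= [RHS]mnT_eta; congr mnT.
by rewrite val_insubd -(mdeg_mnT (bmnm m ord0)) -mnT_eta bmdeg.
Qed.

Lemma sum_mnXY (S : nmodType) N (G : 'X_{1..2} -> S) :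
  \sum_(m : 'X_{1..2 < N}) G m =
  \sum_(ij : 'I_N * 'I_N | (ij.1 + ij.2 < N)%N) G (mnXY ij.1 ij.2).
Proof.
have hpos (ij : 'I_N * 'I_N) : (mdeg (0%MM : 'X_{1..2}) < N)%N.
  by rewrite mdeg0 (leq_ltn_trans _ (ltn_ord ij.1)).
pose i0 (m : 'X_{1..2 < N}) := Ordinal (leq_ltn_trans (leq0n _) (bmdeg m)).
have hN (m : 'X_{1..2 < N}) : (m ord0 + m (inord 1) < N)%N.
  by have := bmdeg m; rewrite {1}(mnXY_eta m) mdeg_mnXY.
rewrite [RHS](reindex_onto
  (fun m : 'X_{1..2 < N} => (insubd (i0 m) (bmnm m ord0), insubd (i0 m) (bmnm m (inord 1))))
  (fun ij => if insub (mnXY ij.1 ij.2) is Some m then m else BMultinom (hpos ij))).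
  have h1 (m : 'X_{1..2 < N}) : insubd (i0 m) (bmnm m ord0) = bmnm m ord0 :> nat.
    by rewrite val_insubd (leq_ltn_trans _ (hN m)) // leq_addr.
  have h2 (m : 'X_{1..2 < N}) : insubd (i0 m) (bmnm m (inord 1)) = bmnm m (inord 1) :> nat.
    by rewrite val_insubd (leq_ltn_trans _ (hN m)) // leq_addl.
  apply: eq_big => [m|m _]; last by rewrite h1 h2 -mnXY_eta.
  by rewrite /= h1 h2 hN -mnXY_eta valK eqxx.
move=> [i j] /= hij; rewrite insubT ?mdeg_mnXY //= => h.
by congr pair; apply: val_inj; rewrite val_insubd ?mnXY_0 ?mnXY_1 ltn_ord.
Qed.

End TruncatedComposition.

(** * Coefficients of the formal group law *)

Section FormalLaw.
Variables (K : fieldType) (vK : valuation K) (F : formal_module vK).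

Lemma mmap1_mnXY (S : comNzRingType) (h : 'I_2 -> S) i j :
  mmap1 h (mnXY i j) = h ord0 ^+ i * h (inord 1) ^+ j.
Proof.
rewrite /mmap1 big_ord_recl big_ord1 mnXY_0.
have -> : lift ord0 ord0 = inord 1 :> 'I_2 by apply: val_inj; rewrite /= inordK.
by rewrite mnXY_1.
Qed.

Lemma mmap1_mnT (S : comNzRingType) (h : 'I_1 -> S) i :
  mmap1 h (mnT i) = h ord0 ^+ i.
Proof. by rewrite /mmap1 big_ord1 mnmE. Qed.

Lemma mps_comp2E (f : mps 2 K) n (A B : mps n K) N m :
  A 0%MM = 0 -> B 0%MM = 0 -> (mdeg m < N)%N ->
  mps_comp2 f A B m = \sum_(ij : 'I_N * 'I_N | (ij.1 + ij.2 < N)%N)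
    coef2 f ij.1 ij.2 * (mps_trunc N A ^+ ij.1 * mps_trunc N B ^+ ij.2)@_m.
Proof.
move=> A0 B0 hm; rewrite /mps_comp2 (@mps_compE _ _ _ _ _ N) //; last first.
  by move=> i; case: ifP.
rewrite /comp_mpoly mmap_trunc.
rewrite (@sum_mnXY _ N (fun m => (f m)%:MP * mmap1 _ m)) raddf_sum.
apply: eq_bigr => ij _ /=; rewrite mcoeffCM mmap1_mnXY !tnth_mktuple /=.
by congr (_ * (_ * _ ^+ _)@_m); rewrite -val_eqE /= inordK.
Qed.

Lemma coef2_law0 i : coef2 (fm_law F) i 0 = (i == 1%N)%:R.
Proof.
have := congr1 (fun f => f (mnT i)) (fm_law0 F) => /=.
(* The level i + 2 exceeds the degree i and is at least 2, so that truncation leaves the variable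
   intact. *)
have hd : (mdeg (mnT i) < i.+2)%N by rewrite mdeg_mnT; lia.
rewrite (mps_comp2E _ _ _ hd) ?var0 //.
rewrite (bigD1 (Ordinal (leqnSn i.+1), Ordinal (ltn0Sn i.+1))) /= ?addn0 ?leqnSn //.
rewrite big1 ?addr0 => [|[k l] /= /andP[_ hkl]].
  rewrite expr0 mulr1 trunc_var // mpolyXn mcoeffX => e.
  have e' : (U_(ord0) *+ i == mnT i)%MM.
    by apply/eqP/mnmP => j; rewrite mulmnE mnm1E mnmE (ord1 j) eqxx mul1n.
  move: e; rewrite e' mulr1 => ->; rewrite /mps_var; congr (_ : bool)%:R.
  apply/eqP/eqP => [/(congr1 (@mdeg 1))|->]; first by rewrite mdeg_mnT mdeg1.
  by apply/mnmP => j; rewrite mnm1E mnmE (ord1 j).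
have -> : mps_trunc i.+2 (fun=> 0 : K) = 0 :> {mpoly K[1]}.
  by apply/mpolyP => m; rewrite mcoeff_trunc mcoeff0 if_same.
rewrite expr0n; have [l0|l0] := eqVneq (l : nat) 0%N; last by rewrite mulr0 mcoeff0 mulr0.
rewrite mulr1 trunc_var // mpolyXn mcoeffX.
case: eqP => [/(congr1 (@mdeg 1))|_]; last by rewrite mulr0.
rewrite mdegMn mdeg1 mdeg_mnT mul1n => ek; case/negP: hkl.
by apply/eqP; congr pair; apply: val_inj.
Qed.

Lemma coef2_lawC i j : coef2 (fm_law F) i j = coef2 (fm_law F) j i.
Proof.
have := congr1 (fun f => f (mnXY i j)) (fm_lawC F) => /=.
pose N := (i + j).+2.
have hd : (mdeg (mnXY i j) < N)%N by rewrite mdeg_mnXY /N; lia.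
have hi : (i < N)%N by rewrite /N; lia.
have hj : (j < N)%N by rewrite /N; lia.
rewrite (mps_comp2E _ _ _ hd) ?var0 //.
have key k l : (('X_(inord 1) : {mpoly K[2]}) ^+ k * 'X_(inord 0) ^+ l)@_(mnXY i j)
    = ((k == j) && (l == i))%:R.
  rewrite !mpolyXn -mpolyXD mcoeffX; congr (_ : bool)%:R.
  have -> : (U_(inord 1) *+ k + U_(inord 0) *+ l)%MM = mnXY l k.
    rewrite [LHS]mnXY_eta !mnmDE !mulmnE !mnm1E; congr mnXY.
      by rewrite -!val_eqE /= !inordK // mul1n mul0n.
    by rewrite -!val_eqE /= !inordK // mul1n mul0n addn0.
  apply/eqP/andP => [e|[/eqP-> /eqP->]] //; split; apply/eqP.
    by have := congr1 (fun m : 'X_{1..2} => m (inord 1)) e; rewrite !mnXY_1.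
  by have := congr1 (fun m : 'X_{1..2} => m ord0) e; rewrite !mnXY_0.
rewrite (bigD1 (Ordinal hj, Ordinal hi)) /=; last by rewrite /N; lia.
rewrite !trunc_var ?/N // key !eqxx mulr1 big1 ?addr0 => [->|[k l] /= /andP[_ hkl]] //.
rewrite key; case: andP => [[/eqP ek /eqP el]|_]; last by rewrite mulr0.
by case/negP: hkl; apply/eqP; congr pair; apply: val_inj.
Qed.

Lemma law_00 : fm_law F 0%MM = 0.
Proof.
rewrite -[RHS](coef2_law0 0) /coef2; congr (fm_law F _).
by apply/mnmP => i; rewrite mnm0E mnmE if_same.
Qed.

Variable pi : K.
Hypothesis pi_int : vint vK pi.
Let phi := fm_act F pi.

Lemma phi_00 : phi 0%MM = 0.
Proof.
rewrite -[RHS](fm_act_coef0 F pi_int) /coef1; congr (fm_act F _ _).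
Qed.

(* Modulo terms of total degree N, phi(X +_F Y) = phi(X) +_F phi(Y). *)
Lemma act_law_trunc N : (1 < N)%N ->
  mord N ((mps_trunc N phi \mPo [tuple mps_trunc N (fm_law F) | _ < 1]) -
          (mps_trunc N (fm_law F) \mPo
             [tuple mps_trunc N phi \mPo [tuple 'X_i | _ < 1] | i < 2])).
Proof.
move=> hN; set A := (X in X - _); set B := (X in _ - X).
have hA : mord N (mps_trunc N (mps_comp1 phi (fm_law F)) - A).
  apply: mps_comp_mord => [_|i]; first exact: law_00.
  by rewrite tnth_mktuple; exact: mord_refl.
have hX (i : 'I_2) : mord N (mps_trunc N (mps_comp1 phi (mps_var K i)) -
    (mps_trunc N phi \mPo [tuple 'X_i | _ < 1])).
  apply: mps_comp_mord => [_|j]; first exact: var0.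
  by rewrite tnth_mktuple trunc_var //; exact: mord_refl.
have hX0 (i : 'I_2) : mps_comp1 phi (mps_var K i) 0%MM = 0.
  have h0 : (mdeg (0%MM : 'X_{1..2}) < 1)%N by rewrite mdeg0.
  rewrite /mps_comp1 (mps_compE _ (fun=> var0 K i) h0).
  apply: (@mord_mPo K 1 2 1) => // [j|].
    by rewrite tnth_mktuple => m hm; rewrite mcoeff_trunc hm;
       have -> : m = 0%MM; [apply/eqP; rewrite -mdeg_eq0; lia|exact: var0].
  move=> m hm; rewrite mcoeff_trunc hm.
  by have -> : m = 0%MM; [apply/eqP; rewrite -mdeg_eq0; lia|exact: phi_00].
have := fm_act_law F pi_int; rewrite -/phi => e.
rewrite e in hA.
have hB : mord N (mps_trunc N (mps_comp2 (fm_law F)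
    (mps_comp1 phi (mps_var K (inord 0))) (mps_comp1 phi (mps_var K (inord 1)))) - B).
  apply: mps_comp_mord => [i|i]; first by case: ifP.
  rewrite tnth_mktuple; case: eqP => [->|/eqP hi].
    by have -> : inord 0 = ord0 :> 'I_2 by apply: val_inj; rewrite /= inordK.
  have -> : inord 1 = i :> 'I_2 by apply: val_inj; rewrite /= inordK //; case: i hi => -[|[|]].
  exact: hX.
rewrite -(subrKA (mps_trunc N (mps_comp2 (fm_law F)
    (mps_comp1 phi (mps_var K (inord 0))) (mps_comp1 phi (mps_var K (inord 1)))))).
by apply: mordD => //; rewrite -opprB; exact: mordN.
Qed.

End FormalLaw.

(** * Completeness of a simple algebraic extension *)

Section SimpleExtension.
Variables (K L : fieldType) (vK : valuation K) (vL : valuation L).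
Variable iota : {rmorphism K -> L}.
Hypothesis ext : extends_val iota vK vL.
Hypothesis Kcomplete : forall u, vcauchy vK u -> exists l, vcvg vK u l.

Lemma vge_iota x c : vge vL (iota x) c = vge vK x c.
Proof.
have [->|x0] := eqVneq x 0; first by rewrite rmorph0 !vge0.
by rewrite !vge_val ?fmorph_eq0 // ext.
Qed.

Lemma vcvg_iota u l : vcvg vK u l -> vcvg vL (fun n => iota (u n)) (iota l).
Proof.
move=> h c; have [N hN] := h c; exists N => n /hN.
by rewrite -rmorphB vge_iota.
Qed.

Variable a : L.

(** The K-span of 1, a, ..., a^(d-1); these powers are not asked to be independent. *)
Definition evals (d : nat) (x : L) :=
  exists2 r : {poly K}, (size r <= d)%N & x = (map_poly iota r).[a].

Lemma evals0 x : evals 0 x -> x = 0.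
Proof.
by case=> r; rewrite leqn0 size_poly_eq0 => /eqP -> ->; rewrite rmorph0 horner0.
Qed.

Lemma evalsB d x y : evals d x -> evals d y -> evals d (x - y).
Proof.
move=> [r hr ->] [s hs ->]; exists (r - s); last by rewrite rmorphB hornerD hornerN.
by rewrite (leq_trans (size_polyD _ _)) // size_polyN geq_max hr.
Qed.

Lemma evalsZ d k x : evals d x -> evals d (iota k * x).
Proof.
move=> [r hr ->]; exists (k *: r); last by rewrite map_polyZ hornerZ.
by rewrite (leq_trans (size_scale_leq _ _)).
Qed.

Lemma evals_recr d x : evals d.+1 x ->
  exists ky : K * L, evals d ky.2 /\ x = iota ky.1 * a ^+ d + ky.2.
Proof.
move=> [r hr ->].
exists (r`_d, (map_poly iota (r - r`_d *: 'X^d)).[a]); split=> /=.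
  exists (r - r`_d *: 'X^d) => //; apply/leq_sizeP => j hj.
  rewrite coefB coefZ coefXn; case: eqP => [->|jd]; first by rewrite mulr1 subrr.
  by rewrite mulr0 subr0; apply: (leq_sizeP _ _ hr); lia.
by rewrite rmorphB /= map_polyZ map_polyXn hornerD hornerN hornerZ hornerXn; ring.
Qed.

Lemma evals_power d : evals d.+1 (a ^+ d).
Proof.
by exists 'X^d; rewrite ?size_polyXn // map_polyXn hornerXn.
Qed.

Lemma evals_le d e x : (d <= e)%N -> evals d x -> evals e x.
Proof. by move=> de [r hr ->]; exists r => //; exact: leq_trans de. Qed.

(** Induction on d. If a^d can be approximated by the span of the lower powers, it lies in that
    span, which is complete by induction, and the next span is no larger. Otherwise the coefficients
    of a^d along the sequence are Cauchy in K, and subtracting their limit reduces to the lower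
    span. *)
Lemma evals_complete d u : (forall n, evals d (u n)) -> vcauchy vL u ->
  exists2 l, evals d l & vcvg vL u l.
Proof.
elim: d u => [|d IH] u hu hC.
  exists 0; first by exists 0; rewrite ?size_poly0 // rmorph0 horner0.
  by apply: (eq_vcvg _ (vcvg_cst vL 0)) => n; rewrite (evals0 (hu n)).
have [far|near] := pselect (exists c, forall y, evals d y -> ~~ vge vL (a ^+ d - y) c); last first.
  have {}near : evals d (a ^+ d).
    have /choice[y hy] : forall n : nat, exists y, evals d y /\ vge vL (a ^+ d - y) n%:R.
      move=> n; apply: contrapT => hn; apply: near; exists n%:R => y hy.
      by apply/negP => hv; apply: hn; exists y.
    have hl : vcvg vL y (a ^+ d).
      move=> c; exists (Num.bound `|c|) => n hn; rewrite vge_subC.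
      apply: (vge_le _ (hy n).2); apply/ltW/(le_lt_trans (ler_norm c)).
      by apply: (lt_le_trans (archi_boundP _)) => //; rewrite ler_nat.
    have [l Sl yl] := IH y (fun n => (hy n).1) (vcvg_cauchy hl).
    by rewrite -(vcvg_unique yl hl).
  have hu' n : evals d (u n).
    have [ky [h ->]] := evals_recr (hu n).
    rewrite (_ : _ + _ = ky.2 - iota (- ky.1) * a ^+ d); first exact: evalsB (evalsZ _ near).
    by rewrite rmorphN mulNr opprK addrC.
  by have [l Sl hl] := IH u hu' hC; exists l => //; exact: evals_le Sl.
have /choice[ky hky] : forall n, exists ky : K * L,
    evals d ky.2 /\ u n = iota ky.1 * a ^+ d + ky.2 by move=> n; exact: evals_recr.
case: far => c far.
(* a^d stays at distance from the span of the lower powers, which bounds the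
   leading coefficient by the element. *)
have lead k y b : evals d y -> vge vL (iota k * a ^+ d + y) b -> vge vK k (b - c).
  have [->|k0] := eqVneq k 0; first by rewrite vge0.
  move=> hy hb; have /negP := far _ (evalsZ (- k^-1) hy).
  have ik0 : iota k != 0 by rewrite fmorph_eq0.
  have -> : a ^+ d - iota (- k^-1) * y = (iota k)^-1 * (iota k * a ^+ d + y).
    by rewrite rmorphN fmorphV mulNr opprK mulrDr mulKf.
  move=> hn; rewrite vge_val // leNgt; apply/negP => hk; apply: hn.
  apply: (@vge_le _ _ (- vK k + b)); first by lra.
  by apply: vgeM => //; rewrite vge_val ?invr_eq0 // vfunV // ext.
have hk : vcauchy vK (fun n => (ky n).1).
  move=> b; have [N hN] := hC (b + c); exists N => m n hm hn.
  have -> : b = b + c - c by rewrite addrK.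
  apply: (lead _ ((ky m).2 - (ky n).2)); first exact: evalsB (hky m).1 (hky n).1.
  have := hN m n hm hn; rewrite (hky m).2 (hky n).2.
  by rewrite opprD addrACA rmorphB mulrBl.
have [k hkl] := Kcomplete hk.
have hkL : vcvg vL (fun n => iota (ky n).1 * a ^+ d) (iota k * a ^+ d).
  rewrite mulrC; apply: (eq_vcvg _ (vcvgMl (a ^+ d) (vcvg_iota hkl))) => n.
  by rewrite mulrC.
have [|l Sl hl] := IH (fun n => (ky n).2) (fun n => (hky n).1).
  apply: (@vcauchy_near _ _ (fun n => u n - iota k * a ^+ d)) => [b|b].
    have [N hN] := hC b; exists N => m n hm hn.
    by rewrite opprB addrA subrK; exact: hN.
  have [N hN] := hkL b; exists N => n /hN; rewrite (hky n).2 => h.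
  rewrite vge_subC (_ : _ - _ - _ = iota (ky n).1 * a ^+ d - iota k * a ^+ d) //.
  ring.
exists (iota k * a ^+ d + l).
  have := evalsB (evalsZ k (evals_power d)) (evalsZ (-1) (evals_le (leqnSn d) Sl)).
  by rewrite rmorphN rmorph1 mulN1r opprK.
by apply: (eq_vcvg _ (vcvgD hkL hl)) => n; rewrite (hky n).2.
Qed.

Definition evaluations (x : L) := exists p : {poly K}, x = (map_poly iota p).[a].

Hypothesis alg : algebraicOver iota a.

(** Division by a polynomial that vanishes at a brings all polynomial expressions in a down to one
    bounded degree. *)
Lemma evaluations_lim u : (forall n, evaluations (u n)) -> vcauchy vL u ->
  exists2 l, evaluations l & vcvg vL u l.
Proof.
case: alg => m m0 ma hu hC.
have [n|l [r _ ->] hl] := @evals_complete (size m) u _ hC; last by exists (map_poly iota r).[a] => //; exists r.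
have [p ->] := hu n; exists (p %% m); first by rewrite ltnW // ltn_modp.
rewrite {1}(divp_eq p m) rmorphD rmorphM hornerD hornerM.
by rewrite (rootP ma) mulr0 add0r.
Qed.

Definition simple_ext : csub vL.
Proof.
apply: (@CSub _ _ evaluations).
- by exists 1; rewrite rmorph1 hornerC.
- by move=> x y [p ->] [r ->]; exists (p - r); rewrite rmorphB hornerD hornerN.
- by move=> x y [p ->] [r ->]; exists (p * r); rewrite rmorphM hornerM.
- exact: evaluations_lim.
Defined.

Lemma simple_ext_gen : simple_ext a.
Proof. by exists 'X; rewrite map_polyX hornerX. Qed.

Lemma simple_ext_iota k : simple_ext (iota k).
Proof. by exists k%:P; rewrite map_polyC hornerC. Qed.

Definition full_csub : csub vK.
Proof.
apply: (@CSub _ _ (fun=> True)) => // u _ /Kcomplete[l hl].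
by exists l.
Defined.

End SimpleExtension.

Section Integrality.
Variables (E : fieldType) (v : valuation E).

Definition mint n (p : {mpoly E[n]}) := forall m, vint v p@_m.

Lemma mint_trunc n N (f : mps n E) : (forall m, vint v (f m)) -> mint (mps_trunc N f).
Proof. by move=> h m; rewrite mcoeff_trunc; case: ifP => // _; exact: vge0. Qed.

Lemma mintB n (p q : {mpoly E[n]}) : mint p -> mint q -> mint (p - q).
Proof. by move=> hp hq m; rewrite mcoeffB; apply: vgeB; [exact: hp|exact: hq]. Qed.

Lemma mintM n (p q : {mpoly E[n]}) : mint p -> mint q -> mint (p * q).
Proof.
move=> hp hq m; rewrite mcoeffM; apply: vge_sum => i _.
by apply: vgeMl; [exact: hp|exact: hq].
Qed.

Lemma mint1 n : mint (1 : {mpoly E[n]}).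
Proof. by move=> m; rewrite mcoeff1; exact: vint_nat. Qed.

Lemma mint_mPo k n (p : {mpoly E[k]}) (lq : k.-tuple {mpoly E[n]}) :
  mint p -> (forall i, mint (tnth lq i)) -> mint (p \mPo lq).
Proof.
move=> hp hq; rewrite comp_mpolyE => m; rewrite raddf_sum; apply: vge_sum => m' _ /=.
rewrite mcoeffZ; apply: vgeMl; first exact: hp.
move: m; rewrite -/(mint _); elim/big_rec: _ => [|i q _ IH]; first exact: mint1.
apply: mintM => //; elim: (m' i) => [|j IHj]; first exact: mint1.
by rewrite exprS; apply: mintM.
Qed.

Lemma mint_X n (i : 'I_n) : mint ('X_i : {mpoly E[n]}).
Proof. by move=> m; rewrite mcoeffX; exact: vint_nat. Qed.

Definition pint (p : {poly E}) := forall i, vint v p`_i.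

Lemma pintX p k : pint p -> pint (p ^+ k).
Proof.
move=> h; elim: k => [|k IH] i; first by rewrite coef1; exact: vint_nat.
rewrite exprS coefM; apply: vge_sum => j _.
by apply: vgeMl; [exact: h|exact: IH].
Qed.

(** In the absence of negative powers, the coefficients of a power up to degree j depend only on
    those of the base up to j. This passes from a polynomial truncation of F(a, T) to the series
    itself. *)
Lemma poly_rlaur_exp (S : csub v) (p : {poly E}) (g : rlaur S) c j k :
  pint p -> lord g 0 -> (forall l, (l <= j)%N -> vge v (p`_l - g l%:Z) c) ->
  forall l, (l <= j)%N -> vge v ((p ^+ k)`_l - (g ^+ k) l%:Z) c.
Proof.
move=> hp hg h; elim: k => [|k IH] l hl; first by rewrite coef1 rl1 subrr vge0.
have hgk : lord (g ^+ k) 0 by have := lordX (n := k) hg; rewrite mul0rn.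
rewrite !exprS coefM coef_rlM // -sumrB; apply: vge_sum => i _.
have hi : (i <= l)%N by rewrite -ltnS.
rewrite subzn //.
have -> : p`_i * (p ^+ k)`_(l - i) - g i * (g ^+ k) (l - i)%N =
    (p`_i - g i) * (p ^+ k)`_(l - i) + g i * ((p ^+ k)`_(l - i) - (g ^+ k) (l - i)%N).
  ring.
apply: vgeD.
  by apply: vgeMr; [apply: h; lia|exact: pintX].
by apply: vgeMl; [exact: rl_int|apply: IH; lia].
Qed.

End Integrality.

(** * The series a +_F T and phi(a +_F T) = phi(T) *)

Section Translate.
Variables (K : fieldType) (L : closedFieldType) (vK : valuation K) (vL : valuation L).
Variable iota : {rmorphism K -> L}.
Hypothesis ext : extends_val iota vK vL.
Hypothesis Kcomplete : forall u, vcauchy vK u -> exists l, vcvg vK u l.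
Variables (F : formal_module vK) (pi : K).
Hypothesis pi_int : vint vK pi.
Variables (a : L) (b : rat).
Hypotheses (alg_a : algebraicOver iota a) (b_gt0 : 0 < b) (hab : vge vL a b).

Let S := simple_ext ext Kcomplete alg_a.
Let law i j := iota (coef2 (fm_law F) i j).
Let phi j := iota (Defs.coef1 (fm_act F pi) j).

Lemma law_int i j : vint vL (law i j).
Proof. by rewrite /vint (vge_iota ext); exact: fm_law_int. Qed.

Lemma phi_int j : vint vL (phi j).
Proof. by rewrite /vint (vge_iota ext); exact: fm_act_int. Qed.

Lemma term_vge c i : vint vL c -> vge vL (c * a ^+ i) (i%:R * b).
Proof. by move=> hc; apply: vgeMl => //; exact: vgeX. Qed.

Lemma S_power i : S (a ^+ i).
Proof. by apply: csubX; exact: simple_ext_gen. Qed.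

Lemma translate_nat j : S (translate vL iota F a j%:Z) /\
  vcvg vL (fun N => \sum_(i < N) law i j * a ^+ i) (translate vL iota F a j%:Z).
Proof.
apply: csub_vlim => [n|].
  by apply: csub_sum => i _; apply: csubM; [exact: simple_ext_iota|exact: S_power].
apply: vcauchyS => c; have [N hN] := archi_mul c b_gt0; exists N => n /hN hn.
rewrite big_ord_recr /= addrAC subrr add0r.
by apply: vge_le (term_vge n (law_int n j)).
Qed.

Lemma translate_approx N j :
  vge vL (translate vL iota F a j%:Z - \sum_(i < N) law i j * a ^+ i) (N%:R * b).
Proof.
apply: (@vcvg_vge _ _ (fun n => \sum_(i < n) law i j * a ^+ i -
    \sum_(i < N) law i j * a ^+ i) _ _ N).
  by apply: vcvgB; [exact: (translate_nat j).2|exact: vcvg_cst].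
move=> n Nn; rewrite -!(big_mkord xpredT (fun i => law i j * a ^+ i)).
rewrite (@big_cat_nat _ _ _ N) //= addrAC subrr add0r big_nat.
apply: vge_sum => i /andP[hi _]; apply: vge_le (term_vge i (law_int i j)).
by rewrite ler_pM2r // ler_nat.
Qed.

Lemma translate_int j : vint vL (translate vL iota F a j).
Proof.
case: j => j; last exact: vge0.
by have := translate_approx 0 j; rewrite big_ord0 subr0 mul0r.
Qed.

Lemma translate_in_R : in_R vL (translate vL iota F a).
Proof.
apply: in_R_intro => [|c]; first exact: translate_int.
by exists 0%N => -[i|i] hi; [lia|exact: vge0].
Qed.

Lemma translate_S j : S (translate vL iota F a j).
Proof. by case: j => j; [exact: (translate_nat j).1|exact: csub0]. Qed.

Definition rltranslate : rlaur S := RLaur translate_in_R translate_S.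

Lemma lord_translate : lord rltranslate 0.
Proof. by case=> [m|m] hm //; lia. Qed.

(** Modulo a the series F(a, T) is F(0, T) = T; this is the approximation that keeps only the term i
    = 0. *)
Lemma translate_near : lge (rltranslate - rlmono S 1) b.
Proof.
case=> m; rewrite rlB; last by rewrite subr0; exact: vge0.
have := translate_approx 1 m; rewrite big_ord1 mulr1 mul1r.
by rewrite /law coef2_lawC coef2_law0 rmorph_nat.
Qed.

(** The constant term has valuation at least b >= w; in degree j >= 1 the required bound w - jw is
    not positive, and integrality suffices. *)
Lemma lw_translate w : 0 <= w -> w <= b -> lw w rltranslate w.
Proof.
move=> w0 wb [[|j]|j]; last exact: vge0.
  rewrite mul0r subr0; apply: (vge_le wb).
  by have := translate_near 0; rewrite rlB subr0.
apply: vge_le (translate_int j.+1).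
have : (1 : rat) <= j.+1%:~R by rewrite ler1n.
nra.
Qed.

Let g : {rmorphism K -> {poly L}} := (polyC \o iota : {rmorphism K -> {poly L}}).
Let h (i : 'I_2) : {poly L} := if i == ord0 then a%:P else 'X.
Let ev : {mpoly K[2]} -> {poly L} := mmap g h.

Lemma h_inord1 : h (inord 1) = 'X.
Proof. by rewrite /h -val_eqE /= inordK. Qed.

(** Under X = a, Y = T a monomial X^i Y^j of total degree at least N becomes a^i T^j with i >= N -
    j. Errors of high total degree thus turn into small coefficients. *)
Lemma ev_mord N p j : mint vK p -> mord N p -> vge vL (ev p)`_j ((N - j)%:R * b).
Proof.
move=> pI pN; rewrite /ev /mmap coef_sum; apply: vge_sum => m _.
rewrite [m]mnXY_eta mmap1_mnXY h_inord1 /h eqxx -rmorphXn coefCM coefCM coefXn.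
case: eqP => [e|_]; last by rewrite !mulr0 vge0.
rewrite mulr1; have [hm|hm] := ltnP (mdeg m) N.
  by rewrite -mnXY_eta pN // rmorph0 mul0r vge0.
apply: (vge_le _ (term_vge _ _)); last by rewrite /vint (vge_iota ext); exact: pI.
rewrite ler_pM2r // ler_nat; move: hm; rewrite [m]mnXY_eta mdeg_mnXY mnXY_0 -e; lia.
Qed.

Lemma ev_law N : ev (mps_trunc N (fm_law F)) =
  \sum_(ij : 'I_N * 'I_N | (ij.1 + ij.2 < N)%N) (law ij.1 ij.2)%:P * (a%:P ^+ ij.1 * 'X ^+ ij.2).
Proof.
rewrite /ev mmap_trunc (@sum_mnXY _ N (fun m => g (fm_law F m) * mmap1 h m)).
by apply: eq_bigr => ij _; rewrite mmap1_mnXY h_inord1.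
Qed.

Lemma ev_law_near N l : (l < N)%N ->
  vge vL ((ev (mps_trunc N (fm_law F)))`_l - rltranslate l%:Z) ((N - l)%:R * b).
Proof.
move=> lN; rewrite ev_law coef_sum.
apply: (@vge_trans _ _ (\sum_(i < N) law i l * a ^+ i)); last first.
  rewrite vge_subC; apply: vge_le (translate_approx N l).
  by rewrite ler_pM2r // ler_nat leq_subr.
rewrite -(pair_big_dep xpredT (fun i j : 'I_N => (i + j < N)%N)
  (fun i j : 'I_N => ((law i j)%:P * (a%:P ^+ i * 'X ^+ j))`_l)) /= -sumrB.
apply: vge_sum => i _; rewrite big_mkcond (bigD1 (Ordinal lN)) //= big1 ?addr0.
  rewrite -rmorphXn !coefCM coefXn eqxx mulr1.
  case: ltnP => hN; first by rewrite subrr vge0.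
  rewrite sub0r vgeN; apply: vge_le (term_vge i (law_int i l)).
  by rewrite ler_pM2r // ler_nat; lia.
move=> j /eqP jl; case: ifP => // _; rewrite -rmorphXn !coefCM coefXn.
by case: eqP => [e|_]; [case: jl; apply: val_inj|rewrite !mulr0].
Qed.

Lemma ev_phi N (lq : 1.-tuple {mpoly K[2]}) :
  ev (mps_trunc N (fm_act F pi) \mPo lq) = \sum_(k < N) (phi k)%:P * ev (tnth lq ord0) ^+ k.
Proof.
rewrite /ev mmap_mPo mmap_trunc.
rewrite (@sum_mnT _ N (fun m => g (fm_act F pi m) * mmap1 _ m)).
by apply: eq_bigr => k _; rewrite mmap1_mnT.
Qed.

(** When phi(a) is small, F(phi(a), phi(T)) is close to F(0, phi(T)) = phi(T). *)
Lemma ev_law_phi N l e : (1 < N)%N -> (l < N)%N -> 0 <= e ->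
  vge vL (\sum_(k < N) phi k * a ^+ k) e ->
  vge vL ((ev (mps_trunc N (fm_law F) \mPo
    [tuple mps_trunc N (fm_act F pi) \mPo [tuple 'X_i | _ < 1] | i < 2]))`_l - phi l) e.
Proof.
move=> N1 lN e0; set A := \sum_(k < N) _ => hA.
rewrite /ev mmap_mPo mmap_trunc (@sum_mnXY _ N (fun m => g (fm_law F m) * mmap1 _ m)).
have ev0 : mmap g h (mps_trunc N (fm_act F pi) \mPo [tuple 'X_ord0 | _ < 1]) = A%:P.
  rewrite -/ev ev_phi tnth_mktuple /ev mmapX mmap1U /h eqxx rmorph_sum.
  by apply: eq_bigr => k _; rewrite rmorphM rmorphXn.
pose P := \sum_(k < N) (phi k)%:P * 'X ^+ k.
have ev1 : mmap g h (mps_trunc N (fm_act F pi) \mPo [tuple 'X_(inord 1) | _ < 1]) = P.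
  by rewrite -/ev ev_phi tnth_mktuple /ev mmapX mmap1U h_inord1.
have P_l i : P`_i = if (i < N)%N then phi i else 0.
  rewrite /P -(coef_poly N phi i) poly_def coef_sum coef_sum.
  by apply: eq_bigr => k _; rewrite mul_polyC.
pose i0 : 'I_N := Ordinal (ltn_trans (ltn0Sn 0) N1).
(* The term X^0 Y^1 yields phi(T). The other terms with i = 0 vanish because F(0, Y) = Y, and those
   with i >= 1 contain the factor phi(a). *)
rewrite (bigD1 (i0, Ordinal N1)) //= mmap1_mnXY !tnth_mktuple ev0 ev1 mul1r.
have law01 : fm_law F (mnXY 0 1) = 1.
  by have := coef2_lawC F 0 1; rewrite coef2_law0.
rewrite law01 rmorph1 mul1r.
rewrite coefD P_l lN addrAC subrr add0r coef_sum; apply: vge_sum => -[i j] /= /andP[_ hij].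
rewrite mmap1_mnXY !tnth_mktuple ev0 ev1 -rmorphXn !coefCM.
case: i hij => -[|i] hi hij.
  rewrite [fm_law F _](_ : _ = coef2 (fm_law F) 0 j) // coef2_lawC coef2_law0.
  case: eqP => [j1|_]; last by rewrite rmorph0 mul0r vge0.
  by case/negP: hij; apply/eqP; congr pair; apply: val_inj.
apply: vgeMl; first exact: law_int.
apply: vgeMr; last first.
  apply: pintX => i'; rewrite P_l; case: ifP => _; [exact: phi_int|exact: vge0].
rewrite exprS; apply: vgeMr => //.
by rewrite /vint -(mulr0 i%:R); apply: vgeX; exact: vge_le hA.
Qed.

(* The series [pi]_F(a +_F T), coefficient by coefficient. *)
Lemma phi_translate l : vcvg vL (fun N => \sum_(j < N) phi j * a ^+ j) 0 ->
  vcvg vL (fun N => \sum_(k < N) phi k * (rltranslate ^+ k) l%:Z) (phi l).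
Proof.
move=> ha c; have [N1 hN1] := ha (Num.max c 0); have [N2 hN2] := archi_mul c b_gt0.
exists (N1 + N2 + l).+2 => N hN.
have NA : vge vL (\sum_(j < N) phi j * a ^+ j) (Num.max c 0).
  by rewrite -[X in vge vL X]subr0; apply: hN1; lia.
have N_gt1 : (1 < N)%N by lia.
have lN : (l < N)%N by lia.
(* Three approximations follow: a +_F T by its truncation P, phi(F(X, Y)) by F(phi(X), phi(Y)) up to
   total degree N, and F(phi(a), phi(T)) by phi(T). *)
pose P := ev (mps_trunc N (fm_law F)).
have PI : pint vL P.
  move=> i; have := @ev_mord 0 (mps_trunc N (fm_law F)) i.
  rewrite sub0n mul0r; apply=> //.
  exact: mint_trunc (@fm_law_int _ _ F).
apply: (@vge_trans _ _ (\sum_(k < N) phi k * (P ^+ k)`_l)).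
  rewrite vge_subC -sumrB; apply: vge_sum => k _; rewrite -mulrBr.
  apply: vgeMl; first exact: phi_int.
  apply: (@poly_rlaur_exp _ _ _ _ _ _ l) => //; first exact: lord_translate.
  move=> i il; apply: vge_le (ev_law_near _); last by lia.
  by apply: hN2; lia.
have -> : \sum_(k < N) phi k * (P ^+ k)`_l =
    (ev (mps_trunc N (fm_act F pi) \mPo [tuple mps_trunc N (fm_law F) | _ < 1]))`_l.
  by rewrite ev_phi tnth_mktuple coef_sum; apply: eq_bigr => k _; rewrite coefCM.
set B := (mps_trunc N (fm_law F) \mPo
    [tuple mps_trunc N (fm_act F pi) \mPo [tuple 'X_i | _ < 1] | i < 2]).
apply: (@vge_trans _ _ (ev B)`_l); last first.
  apply: (@vge_le _ _ (Num.max c 0)); first by rewrite le_max lexx.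
  by apply: ev_law_phi => //; rewrite le_max lexx orbT.
have evB p r : ev p - ev r = ev (p - r) by rewrite /ev raddfB.
rewrite -coefB evB; apply: (@vge_le _ _ ((N - l)%:R * b)); first by apply: hN2; lia.
apply: ev_mord; last exact: act_law_trunc.
have hphi : mint vK (mps_trunc N (fm_act F pi)) by apply: mint_trunc; exact: fm_act_int.
have hF : mint vK (mps_trunc N (fm_law F)) by apply: mint_trunc; exact: fm_law_int.
apply: mintB; apply: mint_mPo => // i; rewrite tnth_mktuple //.
by apply: mint_mPo => // j; rewrite tnth_mktuple; exact: mint_X.
Qed.

End Translate.

(** * The torsion points *)

Section Residue.
Variables (K : fieldType) (v : valuation K) (pi : K) (q : nat).
Hypothesis hK : local_field v pi q.

Lemma vgt0E x : vgt v x 0 = vge v x 1.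
Proof.
have [->|x0] := eqVneq x 0; first by rewrite /vgt /vge eqxx.
rewrite /vgt /vge (negPf x0) /=; have [z ->] := lf_discrete hK x0.
by rewrite ltr0z ler1z; lia.
Qed.

Lemma vint_pi : vint v pi.
Proof. by rewrite /vint (vge_val _ _ (lf_pi_neq0 hK)) (lf_pi hK). Qed.

Lemma vge_pi n : vge v (pi ^+ n) n%:R.
Proof.
by have := @vgeX _ v pi 1 n; rewrite mulr1; apply; rewrite vge_val ?(lf_pi hK) // (lf_pi_neq0 hK).
Qed.

Lemma vge_divpi x c : vge v (pi * x) (c + 1) -> vge v x c.
Proof.
have [->|x0] := eqVneq x 0; first by rewrite vge0.
by rewrite !vge_val ?mulf_neq0 ?(lf_pi_neq0 hK) // vfunM ?(lf_pi_neq0 hK) // (lf_pi hK) => h; lra.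
Qed.

Let cls (x : K) : set K := [set y | vgt v (y - x) 0]%classic.

Lemma cls_eq x y : vge v (x - y) 1 -> cls x = cls y.
Proof.
move=> h; apply/seteqP; split=> z; rewrite /cls /= !vgt0E => hz.
  exact: (vge_trans hz).
by apply: (vge_trans hz); rewrite vge_subC.
Qed.

Lemma cls_inj x y : cls x = cls y -> vge v (x - y) 1.
Proof.
move=> h; have : cls x x by rewrite /cls /= subrr /vgt eqxx.
by rewrite h /cls /= vgt0E.
Qed.

Lemma residue_reps : exists r : nat -> K,
  [/\ forall i j, (i < q)%N -> (j < q)%N -> vge v (r i - r j) 1 -> i = j &
      forall x, vint v x -> exists2 i, (i < q)%N & vge v (x - r i) 1] /\
  forall i, (i < q)%N -> vint v (r i).
Proof.
have := lf_residue hK; rewrite card_eq_sym => /card_set_bijP[f [f1 f2 f3]].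
have /choice[r hr] : forall i, exists x, (i < q)%N -> vint v x /\ f i = cls x.
  move=> i; have [iq|] := boolP (i < q)%N; last by exists 0.
  by have [x hx e] := f1 i iq; exists x => _; split.
exists r; split; last by move=> i /hr[].
split=> [i j iq jq /cls_eq e|x hx].
  apply: f2; rewrite ?inE //; have [_ ->] := hr i iq.
  by have [_ ->] := hr j jq.
have [|i iq e] := f3 (cls x); first by exists x.
by exists i => //; apply: cls_inj; rewrite -e; have [_ ->] := hr i iq.
Qed.

(** 0 and 1 lie in different residue classes. *)
Lemma q_gt1 : (1 < q)%N.
Proof.
have [r [[_ h2] _]] := residue_reps.
have [i iq hi] := h2 0 (vge0 v 0); have [j jq hj] := h2 1 (vint1 v).
suff : i <> j by lia.
move=> e; move: hj; rewrite -e => hj.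
have : vge v 1 1.
  rewrite -[X in vge _ X](subr0 1); apply: (vge_trans hj).
  by rewrite vge_subC.
by rewrite vge_val ?oner_neq0 // vfun1.
Qed.

(* x -> x + 1 permutes the residue classes, so both families of
   representatives have the same sum modulo pi. *)
Lemma vge_q : vge v q%:R 1.
Proof.
have [r [[h1 h2] hr]] := residue_reps.
have /choice[s hs] : forall i : 'I_q, exists j : 'I_q, vge v (r i + 1 - r j) 1.
  move=> i; have [|j jq hj] := h2 (r i + 1); last by exists (Ordinal jq).
  by apply: vgeD; [exact: hr|exact: vint1].
have s_inj : injective s.
  move=> i j e; apply/val_inj/h1; rewrite ?ltn_ord //.
  have hj : vge v (r (s i) - (r j + 1)) 1 by rewrite e vge_subC.
  by have := vge_trans (hs i) hj; rewrite opprD addrACA subrr addr0.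
have : vge v (\sum_(i < q) (r i + 1 - r (s i))) 1 by apply: vge_sum.
have e : \sum_(i < q) r i = \sum_(i < q) r (s i) by exact: reindex_inj.
rewrite sumrB big_split /= e addrAC subrr add0r.
by rewrite sumr_const card_ord.
Qed.

Lemma local_complete u : vcauchy v u -> exists l, vcvg v u l.
Proof. exact: lf_complete hK u. Qed.

End Residue.

Section Evaluation.
Variables (E : fieldType) (v : valuation E).

Lemma vge_horner (p : {poly E}) a b N : pint v p ->
  (forall i, (i < N)%N -> p`_i = 0) -> 0 <= b -> vge v a b -> vge v p.[a] (N%:R * b).
Proof.
move=> hp h b0 hab; rewrite horner_coef; apply: vge_sum => i _.
have [hi|hi] := ltnP i N; first by rewrite h // mul0r vge0.
apply: vgeMl; first exact: hp.
by apply: vge_le (vgeX i hab); rewrite ler_wpM2r // ler_nat.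
Qed.

Lemma vge_divunit x y c d : 0 < d -> vge v (x - 1) d -> vge v (y * x) c -> vge v y c.
Proof.
move=> d0 hx.
have [->|y0] := eqVneq y 0; first by rewrite vge0.
have x0 : x != 0.
  by apply: contraTneq hx => ->; rewrite sub0r vgeN vge_val ?oner_neq0 // vfun1 -ltNge.
have xint : vint v x.
  by apply: (@vge_sub _ _ x 1); [apply: vge_le hx; exact: ltW|exact: vint1].
suff vx : v x = 0 by rewrite !vge_val ?mulf_neq0 // vfunM // vx addr0.
apply/le_anti/andP; split; last by move: xint; rewrite /vint vge_val.
rewrite leNgt; apply/negP => vx.
have : vge v 1 (Num.min (v x) d).
  rewrite -[X in vge _ X](subKr x) ; apply: vgeB.
    by rewrite vge_val // ge_min lexx.
  by apply: vge_le hx; rewrite ge_min lexx orbT.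
by rewrite vge_val ?oner_neq0 // vfun1 leNgt lt_min vx d0.
Qed.

End Evaluation.

Section PowerSeries.
Variables (E : fieldType) (v : valuation E) (S : csub v) (f : nat -> E).
Hypotheses (f_int : forall j, vint v (f j)) (f_S : forall j, S (f j)).

Lemma laurent_of_ps_in_R : in_R v (laurent_of_ps f).
Proof.
apply: in_R_intro => [[m|m]|c]; [exact: f_int|exact: vge0|].
by exists 0%N => -[i|i] hi; [lia|exact: vge0].
Qed.

Lemma laurent_of_ps_S m : S (laurent_of_ps f m).
Proof. by case: m => m; [exact: f_S|exact: csub0]. Qed.

Definition rlps : rlaur S := RLaur laurent_of_ps_in_R laurent_of_ps_S.

Lemma lord_rlps : lord rlps 0.
Proof. by case=> [m|m] hm //; lia. Qed.

Lemma rlps_near (q : nat) c :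
  (forall j, vge v (f j - (j == q)%:R) c) -> lge (rlps - rlmono S q) c.
Proof. by move=> h [m|m]; rewrite rlB; [exact: h|rewrite subr0; exact: vge0]. Qed.

End PowerSeries.

Section Torsion.
Variables (K : fieldType) (vK : valuation K) (pi : K) (q : nat).
Variables (L : closedFieldType) (iota : {rmorphism K -> L}) (vL : valuation L).
Variable F : formal_module vK.
Hypotheses (hK : local_field vK pi q) (hL : alg_closure iota).
Hypotheses (ext : extends_val iota vK vL) (hF : lubin_tate pi q F).

Let phi j := Defs.coef1 (fm_act F pi) j.
Let w : rat := (q%:R - 1)^-1.

Lemma q1_gt0 : 0 < q%:R - 1 :> rat.
Proof. by rewrite subr_gt0 ltr1n; exact: q_gt1 hK. Qed.

Lemma w_gt0 : 0 < w.
Proof. by rewrite invr_gt0 q1_gt0. Qed.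

Lemma w_q : (q%:R - 1) * w = 1.
Proof. by rewrite mulfV //; apply: lt0r_neq0; exact: q1_gt0. Qed.

Lemma phi0 : phi 0 = 0.
Proof. exact: fm_act_coef0 (vint_pi hK). Qed.

Lemma phi1 : phi 1 = pi.
Proof. exact: fm_act_coef1 (vint_pi hK). Qed.

Lemma phi_integral j : vint vK (phi j).
Proof. exact: fm_act_int (vint_pi hK) _. Qed.

Lemma phi_near j : vge vK (phi j - (j == q)%:R) 1.
Proof. by have := hF j; rewrite (lf_pi hK). Qed.

Let SK := full_csub (local_complete hK).

Definition phiK : rlaur SK := rlps (S := SK) phi_integral (fun=> I).

(** The preparation takes place over K, which is complete; P and the unit y are then mapped to L,
    where P splits into linear factors. *)
Lemma weierstrass_poly : exists (P : {poly L}) (y : nat -> L),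
  [/\ P \is monic, size P = q.+1, forall i, (i < q)%N -> vge vL P`_i 1, P`_0 = 0 &
      forall j, vge vL (y j - (j == 0)%:R) 1] /\
  forall i, P`_i = \sum_(j < i.+1) iota (phi j) * y (i - j)%N.
Proof.
have [y [y0 y1 hy]] := weierstrass (ltr01 : 0 < 1 :> rat) (lord_rlps _ _ : lord phiK 0)
  (rlps_near _ _ phi_near).
pose P := \poly_(i < q.+1) iota ((phiK * y) i%:Z).
have P_q : P`_q = 1 by rewrite coef_poly ltnSn hy // eqxx rmorph1.
have size_P : size P = q.+1.
  by apply/eqP; rewrite size_poly_eq // hy // eqxx rmorph1 oner_neq0.
exists P, (fun j => iota (y j%:Z)).
have P_i i : P`_i = \sum_(j < i.+1) iota (phi j) * iota (y (i - j)%N).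
  transitivity (iota ((phiK * y) i%:Z)).
    rewrite coef_poly; case: ltnP => // hi; rewrite hy; last by lia.
    by rewrite (_ : (i%:Z == q%:Z) = false) ?rmorph0 //; lia.
  rewrite coef_rlM //; last exact: lord_rlps.
  rewrite rmorph_sum; apply: eq_bigr => j _; rewrite rmorphM subzn //.
  by have := ltn_ord j; lia.
split=> //; split=> //.
- by rewrite monicE lead_coefE size_P P_q.
- move=> i iq; rewrite coef_poly ltnS (ltnW iq) (vge_iota ext).
  have : lge (phiK * y - rlmono SK q) 1.
    have -> : phiK * y - rlmono SK q = (phiK - rlmono SK q) * y + rlmono SK q * (y - 1).
      ring.
    by apply: lgeD; [apply/lgeMr/rlps_near/phi_near|exact: lgeMl].
  move=> /(_ i%:Z); rewrite rlB /= /lmono (_ : (i%:Z == q%:Z) = false) ?subr0 //; lia.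
- by rewrite P_i big_ord1 phi0 rmorph0 mul0r.
- by move=> j; rewrite -(rmorph_nat iota) -rmorphB (vge_iota ext); have := y1 j; rewrite rlB.
Qed.

Section Roots.
Variables (P : {poly L}) (y : nat -> L).
Hypotheses (Pmonic : P \is monic) (Psize : size P = q.+1).
Hypotheses (P_small : forall i, (i < q)%N -> vge vL P`_i 1) (P_0 : P`_0 = 0).
Hypotheses (y_near : forall j, vge vL (y j - (j == 0)%:R) 1).
Hypotheses (P_coef : forall i, P`_i = \sum_(j < i.+1) iota (phi j) * y (i - j)%N).

(** The Newton polygon argument: if v(a) < w, every other term of P(a) has larger valuation than
    a^q, and the sum cannot vanish. *)
Lemma root_weight a : root P a -> vge vL a w.
Proof.
move=> /rootP Pa; have [->|a0] := eqVneq a 0; first exact: vge0.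
rewrite vge_val // leNgt; apply/negP => va.
have va1 : 0 < 1 - (q%:R - 1) * vL a.
  rewrite (_ : 1 - _ = (q%:R - 1) * (w - vL a)); last by rewrite mulrBr w_q.
  apply: mulr_gt0; first exact: q1_gt0.
  by rewrite subr_gt0.
(* The margin 1 - (q - i) v(a) between the term of degree i, 1 <= i < q, and a^q is at least 1 - (q
   - 1) v(a) if v(a) >= 0, and at least 1 if v(a) < 0. *)
pose d := Num.min 1 (1 - (q%:R - 1) * vL a).
have d0 : 0 < d by rewrite lt_min ltr01.
have eq : a ^+ q = - \sum_(i < q) P`_i * a ^+ i.
  move: Pa; rewrite horner_coef Psize big_ord_recr /=.
  have -> : P`_q = 1 by move: Pmonic; rewrite monicE lead_coefE Psize => /eqP.
  by rewrite mul1r addrC => /eqP; rewrite addr_eq0 => /eqP.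
have : vge vL (a ^+ q) (q%:R * vL a + d).
  rewrite eq vgeN; apply: vge_sum => -[[|i] iq] _ /=; first by rewrite P_0 mul0r vge0.
  apply: (@vge_le _ _ (1 + i.+1%:R * vL a)); last first.
    by apply: vgeM; [exact: P_small|rewrite vge_val ?expf_neq0 // vfunX].
  have hi : (1 : rat) <= i.+1%:R by rewrite ler1n.
  have hiq : (i.+1%:R : rat) <= q%:R by rewrite ler_nat ltnW.
  have [hv|hv] := leP 0 (vL a).
    have : d <= 1 - (q%:R - 1) * vL a by rewrite ge_min lexx orbT.
    nra.
  have : d <= 1 by rewrite ge_min lexx.
  nra.
rewrite vge_val ?expf_neq0 // vfunX //; lra.
Qed.

Let Phi N : {poly L} := \poly_(j < N) iota (phi j).
Let Theta N : {poly L} := \poly_(j < N) y j.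

Lemma y_int j : vint vL (y j).
Proof.
apply: (vge_sub (vge_le _ (y_near j))); first exact: ler01.
exact: vint_nat.
Qed.

Lemma Phi_int N : pint vL (Phi N).
Proof.
move=> i; rewrite coef_poly; case: ifP => _; last exact: vge0.
by rewrite /vint (vge_iota ext); exact: phi_integral.
Qed.

Lemma Theta_int N : pint vL (Theta N).
Proof.
by move=> i; rewrite coef_poly; case: ifP => _; [exact: y_int|exact: vge0].
Qed.

Lemma P_int : pint vL P.
Proof.
move=> i; rewrite P_coef; apply: vge_sum => j _; apply: vgeMl; last exact: y_int.
by rewrite /vint (vge_iota ext); exact: phi_integral.
Qed.

Let D N := P - Phi N * Theta N.

Lemma D_int N : pint vL (D N).
Proof.
move=> i; rewrite coefB; apply: vgeB; first exact: P_int.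
by rewrite coefM; apply: vge_sum => j _; apply: vgeMl; [exact: Phi_int|exact: Theta_int].
Qed.

Lemma D_low N i : (i < N)%N -> (D N)`_i = 0.
Proof.
move=> iN; rewrite coefB P_coef coefM; apply/eqP; rewrite subr_eq0; apply/eqP.
apply: eq_bigr => j _; rewrite !coef_poly !ifT //; have := ltn_ord j; lia.
Qed.

Lemma Theta_unit N a b : 0 < b -> vge vL a b ->
  vge vL ((Theta N.+1).[a] - 1) (Num.min 1 b).
Proof.
move=> b0 hab; rewrite horner_poly big_ord_recl expr0 mulr1 addrAC; apply: vgeD.
  by apply: vge_le (y_near 0); rewrite ge_min lexx.
apply: vge_sum => i _; apply: vgeMl; first exact: y_int.
apply: (@vge_le _ _ b); first by rewrite ge_min lexx orbT.
rewrite /= exprS; apply: vgeMr => //.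
by rewrite /vint -(mulr0 i%:R); apply: vgeX; apply: vge_le hab; exact: ltW.
Qed.

(** P(a) is the product of the truncations of phi and y at a up to valuation Nb, and the value of y
    is a unit, being 1 modulo the maximal ideal. With truncations throughout, no value of y at a has
    to exist as a limit. *)
Lemma root_torsion a b : 0 < b -> vge vL a b ->
  root P a <-> vcvg vL (fun N => \sum_(j < N) iota (phi j) * a ^+ j) 0.
Proof.
move=> b0 hab.
have hPhi N : \sum_(j < N) iota (phi j) * a ^+ j = (Phi N).[a] by rewrite horner_poly.
have hD N : vge vL (P.[a] - (Phi N).[a] * (Theta N).[a]) (N%:R * b).
  by rewrite -hornerM -hornerN -hornerD; apply: vge_horner (@D_int N) (@D_low N) (ltW b0) hab.
split=> [/rootP Pa c|h].
  have [N hN] := archi_mul c b0; exists N.+1 => -[//|n] hn.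
  rewrite subr0 hPhi.
  apply: (@vge_divunit _ _ (Theta n.+1).[a] _ _ (Num.min 1 b)); first by rewrite lt_min ltr01.
    exact: Theta_unit.
  rewrite -vgeN -sub0r -Pa; apply: vge_le (hD n.+1).
  by apply: hN; exact: ltnW.
apply/rootP; apply: (@vge_inf _ vL) => c.
have [N hN] := h c; have [N' hN'] := archi_mul c b0.
apply: (@vge_sub _ _ _ ((Phi (N + N')%N).[a] * (Theta (N + N')%N).[a])).
  by apply: vge_le (hD _); apply: hN'; exact: leq_addl.
apply: vgeMr; first by rewrite -hPhi -[X in vge _ X]subr0; apply: hN; exact: leq_addr.
have := vge_horner (N := 0) (@Theta_int (N + N')) _ (ltW b0) hab.
by rewrite mul0r; apply.
Qed.

Lemma exp_coef01 (S : csub vL) (f : rlaur S) k : lord f 0 ->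
  (f ^+ k) 0 = f 0 ^+ k /\ (f ^+ k.+1) 1 = f 0 ^+ k * f 1 *+ k.+1.
Proof.
move=> f0; have h0 n : lord (f ^+ n) 0 by have := lordX (n := n) f0; rewrite mul0rn.
have e0 n : (f ^+ n) 0 = f 0 ^+ n.
  elim: n => [|n IH]; first by rewrite rl1.
  by rewrite exprS (@coef_rlM _ _ _ _ _ 0) // big_ord1 subr0 IH exprS.
split=> //; elim: k => [|k IH]; first by rewrite expr1 mul1r.
rewrite exprS (@coef_rlM _ _ _ _ _ 1) // big_ord_recl big_ord1 /= !subr0 subrr.
rewrite IH e0 [RHS]mulrSr; congr (_ + _); last exact: mulrC.
by rewrite mulrnAr exprS mulrA.
Qed.

(** The coefficient of T in phi(a +_F T) = phi(T) gives phi'(a) F_Y(a, 0) = pi, which is not 0. If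
    P'(a) = 0, then differentiating P = phi y at a, where phi(a) = 0 and y(a) is a unit, would give
    phi'(a) = 0. *)
Lemma root_simple a : root P a -> P^`().[a] != 0.
Proof.
move=> Pa; have hab := root_weight Pa; have b0 := w_gt0.
have ht := (root_torsion b0 hab).1 Pa; apply/eqP => P'a.
have := phi_translate ext (local_complete hK) (vint_pi hK) (hL a) b0 hab 1 ht.
set f := rltranslate _ _ _ _ _ _ _.
have f_ord : lord f 0 by exact: lord_translate.
have f_0 : f 0 = a.
  apply: (@eq_vge _ vL) => c; have [N hN] := archi_mul c b0.
  have := translate_approx ext (local_complete hK) F (hL a) b0 hab N.+2 0.
  rewrite (bigD1 (Ordinal (isT : (1 < N.+2)%N))) //= big1 => [|i hi].
    rewrite coef2_law0 rmorph1 mul1r expr1 addr0; apply: vge_le; apply: hN; lia.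
  rewrite coef2_law0 (_ : (_ == _) = false) ?rmorph0 ?mul0r //.
  by apply/negP => /eqP e; case/negP: hi; apply/eqP/val_inj.
(* The chain rule at T = 0 for the truncations of phi, using f(0) = a. *)
have e N : \sum_(k < N) iota (Defs.coef1 (fm_act F pi) k) * (f ^+ k) 1%:Z =
    (Phi N)^`().[a] * f 1.
  case: N => [|N]; first by rewrite big_ord0 /Phi poly_def big_ord0 linear0 horner0 mul0r.
  rewrite big_ord_recl expr0 rl1 mulr0 add0r /Phi.
  have -> : (\poly_(j < N.+1) iota (phi j))^`() = \poly_(j < N) (iota (phi j.+1) *+ j.+1).
    apply/polyP => i; rewrite coef_deriv !coef_poly ltnS.
    by case: ifP => //; rewrite mul0rn.
  rewrite horner_poly mulr_suml; apply: eq_bigr => i _.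
  by rewrite (exp_coef01 _ f_ord).2 f_0 /bump /=; ring.
move=> h0.
suff h1 : vcvg vL (fun N => (Phi N)^`().[a] * f 1) 0.
  have := vcvg_unique (eq_vcvg e h0) h1; rewrite -/(phi 1) phi1 => /eqP.
  by rewrite fmorph_eq0 (negPf (lf_pi_neq0 hK)).
have D'0 N : vge vL (D N.+1)^`().[a] (N%:R * w).
  apply: (vge_horner _ _ (ltW b0) hab) => i; rewrite coef_deriv.
    by rewrite -mulr_natr; apply: vgeMl; [exact: D_int|exact: vint_nat].
  by move=> iN; rewrite D_low // mul0rn.
have Theta'_int N : vint vL (Theta N)^`().[a].
  have := @vge_horner _ vL (Theta N)^`() a w 0; rewrite mul0r; apply => //; last exact: ltW.
  by move=> i; rewrite coef_deriv -mulr_natr; apply: vgeMl; [exact: Theta_int|exact: vint_nat].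
have main c : exists N, forall n, (N <= n)%N -> vge vL (Phi n)^`().[a] c.
  have [N hN] := ht c; have [N' hN'] := archi_mul c b0.
  exists (N + N').+1 => -[//|n] hn.
  apply: (@vge_divunit _ _ (Theta n.+1).[a] _ _ (Num.min 1 w)); first by rewrite lt_min ltr01.
    exact: Theta_unit.
  have -> : (Phi n.+1)^`().[a] * (Theta n.+1).[a] =
      - (D n.+1)^`().[a] - (Phi n.+1).[a] * (Theta n.+1)^`().[a].
    rewrite /D derivB derivM !hornerE P'a; ring.
  apply: vgeB; first by rewrite vgeN; apply: vge_le (D'0 n); apply: hN'; lia.
  apply: vgeMr => //; rewrite horner_poly -[X in vge _ X]subr0; apply: hN; lia.
move=> c; have [N hN] := main c; exists N => n /hN hn; rewrite subr0.
by apply: vgeMr => //; exact: rl_int.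
Qed.

End Roots.

Lemma torsion_seq : exists rs : seq L,
  [/\ uniq rs, size rs = q, (torsion vL iota pi F = [set` rs])%classic &
      forall a, a \in rs -> vge vL a w].
Proof.
have [P [y [[Pmonic Psize P_small P_0 y_near] P_coef]]] := weierstrass_poly.
have [rs] := closed_field_poly_normal P; rewrite (monicP Pmonic) scale1r => eP.
have mem_rs a : (a \in rs) = root P a by rewrite eP root_prod_XsubC.
exists rs; split.
- rewrite -separable_prod_XsubC -eP unlock; apply/Pdiv.ClosedField.coprimepP => a.
  exact: (root_simple Pmonic Psize P_small P_0 y_near P_coef).
- by apply/eqP; rewrite -eqSS -Psize eP size_prod_XsubC.
- apply/seteqP; split=> a /=; rewrite mem_rs.
    (* The value [vL 0] is unspecified and offers no positive bound for a = 0, so this root is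
       treated apart. *)
    case=> ha h; have [a0|a0] := eqVneq a 0.
      by apply/rootP; rewrite a0 horner_coef0.
    have va : 0 < vL a by move: ha; rewrite /vgt (negPf a0).
    have hva : vge vL a (vL a) by rewrite vge_val.
    exact: (root_torsion Pmonic Psize y_near P_coef va hva).2 h.
  move=> Pa; have hw := root_weight Pmonic Psize P_small P_0 Pa; split.
    by move: hw; rewrite /vge /vgt => /orP[->//|h]; rewrite (lt_le_trans w_gt0 h) orbT.
  exact: (root_torsion Pmonic Psize y_near P_coef w_gt0 hw).1.
- by move=> a; rewrite mem_rs; exact: root_weight.
Qed.

End Torsion.

(** * The Coleman trace *)

Section BaseChange.
Variables (K L : fieldType) (vK : valuation K) (vL : valuation L).
Variables (iota : {rmorphism K -> L}) (SK : csub vK) (SL : csub vL).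
Hypotheses (ext : extends_val iota vK vL) (hS : forall x, SL (iota x)).

Definition rlmap (f : rlaur SK) : rlaur SL.
Proof.
apply: (@RLaur _ _ _ (fun m => iota (f m))) => //.
apply: in_R_intro => [m|c]; first by rewrite /vint (vge_iota ext); exact: rl_int.
have [N hN] := in_R_tail c (rl_R f); exists N => i hi.
by rewrite (vge_iota ext); exact: hN.
Defined.

Lemma rlmapM f g : rlmap (f * g) = rlmap f * rlmap g.
Proof.
apply: ismul_rlmul => m; apply: (eq_vcvg _ (vcvg_iota ext (rlM f g m))) => n.
by rewrite /lpartial rmorph_sum; apply: eq_bigr => i _; rewrite rmorphM.
Qed.

Lemma rlmap1 : rlmap 1 = 1.
Proof. by apply: rlaurP => m; rewrite /= /lmono rmorph_nat. Qed.

Lemma rlmapX f n : rlmap (f ^+ n) = rlmap f ^+ n.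
Proof. by elim: n => [|n IH]; rewrite ?rlmap1 // !exprS rlmapM IH. Qed.

Lemma rlmap_lw w f c : lw w f c -> lw w (rlmap f) c.
Proof. by move=> h m; rewrite (vge_iota ext). Qed.

Lemma rlmap_lord f N : lord f N -> lord (rlmap f) N.
Proof. by move=> h m hm; rewrite /= h // rmorph0. Qed.

End BaseChange.

(** * The conjugates g(a +_F T) *)

Section Conjugate.
Variables (K : fieldType) (vK : valuation K) (pi : K) (q : nat).
Variables (L : closedFieldType) (iota : {rmorphism K -> L}) (vL : valuation L).
Variable F : formal_module vK.
Hypotheses (hK : local_field vK pi q) (hL : alg_closure iota).
Hypotheses (ext : extends_val iota vK vL) (hF : lubin_tate pi q F).

Let phi j := Defs.coef1 (fm_act F pi) j.
Let w : rat := (q%:R - 1)^-1.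
Let w_gt0 : 0 < w := w_gt0 hK.
Let w_q : (q%:R - 1) * w = 1 := w_q hK.
Let phiK := phiK F hK.

Lemma phi_weight j : vge vK (phi j) ((q%:R - j%:R) * w).
Proof.
have [->|j0] := eqVneq j 0; first by rewrite [phi 0](phi0 F hK) vge0.
have h1 : (1 : rat) <= j%:R by rewrite ler1n lt0n.
have [->|jq] := eqVneq j q; first by rewrite subrr mul0r; exact: (phi_integral F hK).
have := phi_near hK hF j; rewrite (negPf jq) subr0; apply: vge_le.
have hw : 0 <= (j%:R - 1) * w by rewrite mulr_ge0 ?(ltW w_gt0) // subr_ge0.
by have := w_q; lra.
Qed.

Lemma lw_phiK : lw w phiK (q%:R * w).
Proof.
by case=> m; [have := phi_weight m; rewrite mulrBl|exact: vge0].
Qed.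

Lemma lord_phiK : lord phiK 1.
Proof. by case=> [[|m]|m] hm; [exact: (phi0 F hK)|lia|]. Qed.

Lemma lord_phiK0 : lord phiK 0.
Proof. exact: lord_rlps. Qed.

Lemma phiK_inverse : exists y, phiK * y = 1.
Proof.
exact: (inverse_near_mono (ltr01 : 0 < 1 :> rat) (rlps_near _ _ (phi_near hK hF))).
Qed.

Variable thetaK : rlaur (full_csub (local_complete hK)).
Hypothesis phi_theta : phiK * thetaK = 1.

Variable a : L.
Hypotheses (aw : vge vL a w)
  (a_torsion : vcvg vL (fun N => \sum_(j < N) iota (phi j) * a ^+ j) 0).

Let S := simple_ext ext (local_complete hK) (hL a).
Let f : rlaur S := rltranslate ext (local_complete hK) F (vint_pi hK) (hL a) w_gt0 aw.
Let toL : rlaur (full_csub (local_complete hK)) -> rlaur S :=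
  rlmap ext (simple_ext_iota ext (local_complete hK) (hL a)).

Lemma lw_f : lw w f w.
Proof. by apply: lw_translate => //; exact: ltW w_gt0. Qed.

Lemma lord_fX k : lord (f ^+ k) 0.
Proof.
have h : lord f 0 by exact: lord_translate.
by have := lordX (n := k) h; rewrite mul0rn.
Qed.

Let psi_term m k := iota (phi k.+1) * (f ^+ k) m%:Z.

Lemma psi_term_vge m k : vge vL (psi_term m k) (k%:R * w - m%:R * w).
Proof.
apply: vgeMl; first by rewrite /vint (vge_iota ext); exact: (phi_integral F hK).
exact: (lwX k lw_f m).
Qed.

Lemma psi_term_S m k : S (psi_term m k).
Proof. by apply: csubM; [exact: simple_ext_iota|exact: rl_S]. Qed.

Let psi_coef m := vlim vL (fun N => \sum_(k < N) psi_term m k).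

Lemma psi_coef_cvg m : S (psi_coef m) /\
  vcvg vL (fun N => \sum_(k < N) psi_term m k) (psi_coef m).
Proof.
apply: csub_vlim => [n|]; first by apply: csub_sum => k _; exact: psi_term_S.
apply: vcauchyS => c; have [N hN] := archi_mul (c + m%:R * w) w_gt0.
exists N => n /hN hn; rewrite big_ord_recr /= addrAC subrr add0r.
by apply: vge_le (psi_term_vge m n); lra.
Qed.

Lemma psi_coef_vge m c : (forall k, vge vL (psi_term m k) c) -> vge vL (psi_coef m) c.
Proof.
by move=> h; apply: (vcvg_vge (N := 0) (psi_coef_cvg m).2) => n _; exact: vge_sum.
Qed.

Lemma psi_coef_int m : vint vL (psi_coef m).
Proof.
apply: psi_coef_vge => k; apply: vgeMl; last exact: rl_int.
by rewrite /vint (vge_iota ext); exact: (phi_integral F hK).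
Qed.

(* The composition of phi / T with a +_F T. *)
Let psi : rlaur S := rlps psi_coef_int (fun m => (psi_coef_cvg m).1).

(** phi/T has weight qw - w = 1, and a +_F T has weight at least w, like T. *)
Lemma lw_psi : lw w psi 1.
Proof.
case=> m; last exact: vge0.
apply: psi_coef_vge => k.
have -> : 1 - m%:~R * w = (q%:R - k.+1%:R) * w + (k%:R * w - m%:~R * w).
  by have := w_q; rewrite -[k.+1%:R]natr1; lra.
apply: vgeM; last exact: (lwX k lw_f m).
by rewrite (vge_iota ext); exact: phi_weight.
Qed.

(** This is phi(a +_F T) = phi(T) with one factor a +_F T split off. It presents the inverse of a
    +_F T as psi / phi, a form whose poles are cancelled by powers of phi. *)
Lemma f_psi : f * psi = toL phiK.
Proof.
apply: rlaurP => -[m|m]; last first.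
  have h : lord (f * psi) 0.
    by have := lordM (lord_fX 1) (lord_rlps psi_coef_int (fun m => (psi_coef_cvg m).1)).
  by rewrite h //= rmorph0.
rewrite coef_rlM; [|exact: (lord_fX 1)|exact: lord_rlps].
have h1 := phi_translate ext (local_complete hK) (vint_pi hK) (hL a) w_gt0 aw m a_torsion.
apply: vcvg_unique _ h1.
have h2 : vcvg vL (fun N => \sum_(i < m.+1) f i%:Z * \sum_(k < N) psi_term (m - i) k)
    (\sum_(i < m.+1) f i%:Z * psi (m%:Z - i%:Z)).
  apply: vcvg_sum => i _; apply: vcvgMl; rewrite subzn; last by have := ltn_ord i; lia.
  exact: (psi_coef_cvg _).2.
move=> c; have [N hN] := h2 c; exists N.+1 => -[//|n] hn.
rewrite big_ord_recl /= (phi0 F hK) rmorph0 mul0r add0r.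
set X := (X in X - _).
have -> : X = \sum_(i < m.+1) f i%:Z * \sum_(k < n) psi_term (m - i) k; last first.
  exact: hN.
under [RHS]eq_bigr do rewrite mulr_sumr.
rewrite exchange_big; apply: eq_bigr => k _ /=.
rewrite -/f exprS coef_rlM; [|exact: (lord_fX 1)|exact: lord_fX].
rewrite mulr_sumr; apply: eq_bigr => i _; rewrite subzn; last by have := ltn_ord i; lia.
by rewrite /psi_term mulrCA.
Qed.

Let f' : rlaur S := psi * toL thetaK.

Lemma f_f' : f * f' = 1.
Proof. by rewrite mulrA f_psi -rlmapM phi_theta rlmap1. Qed.

Variables (g : rlaur (full_csub (local_complete hK))) (n : nat).

Let G m := lcomp vL (fun k => iota (g k)) (translate vL iota F a) m.

Let Gr : rlaur S := rlcomp f_f' (ltW w_gt0) w_gt0 lw_f (lord_fX 1) (toL g).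

Lemma conjugate_near m : vge vL (G m - iota (g m)) w.
Proof.
have := @rlcomp_sub _ _ _ _ _ _ _ f_f' (ltW w_gt0) w_gt0 lw_f (lord_fX 1) (toL g) 1 m 0 w.
rewrite mul1r add0r; apply => //; first exact: rl_int.
exact: translate_near.
Qed.

(* phi^n (a +_F T)^k = phi^(n+k) psi^(-k) for k < 0. *)
Lemma phi_pow_f (k : int) : - n%:Z <= k ->
  lw w (toL phiK ^+ n * pw f f' k) (n%:R * (q%:R * w) + k%:~R * w) /\
  lord (toL phiK ^+ n * pw f f' k) (if k < 0 then n%:Z + k else n%:Z).
Proof.
have lwp : lw w (toL phiK) (q%:R * w) by exact: rlmap_lw lw_phiK.
have lop : lord (toL phiK) 1 by exact: rlmap_lord lord_phiK.
case: k => [k|k] hk /=.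
  split; first by apply: lwM; [exact: lwX|exact: (lwX k lw_f)].
  by have := lordM (lordX (n := n) lop) (lord_fX k); rewrite addr0 natz.
have [d ed] : exists d, n = (d + k.+1)%N by exists (n - k.+1)%N; lia.
have -> : toL phiK ^+ n * f' ^+ k.+1 = toL phiK ^+ d * psi ^+ k.+1.
  rewrite ed exprD -mulrA -exprMn; congr (_ * _ ^+ _).
  by rewrite /f' mulrCA -rlmapM phi_theta rlmap1 mulr1.
split.
  have -> : n%:R * (q%:R * w) + (Negz k)%:~R * w = d%:R * (q%:R * w) + k.+1%:R * 1.
    rewrite -[X in _ = _ + _ * X]w_q ed natrD NegzE mulrNz; ring.
  by apply: lwM; [exact: lwX|apply: lwX; exact: lw_psi].
have lpsi : lord psi 0 by exact: lord_rlps.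
have := lordM (lordX (n := d) lop) (lordX (n := k.+1) lpsi).
by rewrite mul0rn addr0 natz; congr lord; lia.
Qed.

Lemma conjugate_cvg j : vcvg vL
  (lpartial (fun i => iota ((phiK ^+ n) i) * G (j - i))) ((toL phiK ^+ n * Gr) j).
Proof.
by apply: eq_vcvg (rlM (toL phiK ^+ n) Gr j) => N; apply: eq_bigr => i _; rewrite -rlmapX.
Qed.

Hypothesis g_supp : forall k, k < - n%:Z -> g k = 0.

Lemma conjugate_terms j : vcvg vL
  (lpartial (fun k => toL g k * (toL phiK ^+ n * pw f f' k) j)) ((toL phiK ^+ n * Gr) j).
Proof.
apply: rlcomp_cont; have := lordX (n := n) (rlmap_lord (iota := iota) _ _ lord_phiK0).
by rewrite mul0rn; apply.
Qed.

Lemma conjugate_lord : lord (toL phiK ^+ n * Gr) 0.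
Proof.
move=> j j0; apply: (@vge_inf _ vL) => c; apply: (lcvg_vge (conjugate_terms j)) => k.
have [hk|hk] := ltP k (- n%:Z); first by rewrite /= g_supp // rmorph0 mul0r vge0.
rewrite (phi_pow_f hk).2 ?mulr0 ?vge0 //; case: ifP; lia.
Qed.

(** For M >= 0 the bound is available at every k. For M < 0 it is available only for k <= M, and the
    remaining terms phi^n (a +_F T)^k start beyond T^j. *)
Lemma conjugate_weight (M j : int) C :
  (forall k, k <= M \/ 0 <= M -> vge vK (g k) (C - k%:~R * w)) -> j <= M + n%:Z ->
  vge vL ((toL phiK ^+ n * Gr) j) (C + n%:R * (q%:R * w) - j%:~R * w).
Proof.
move=> hg hj; apply: (lcvg_vge (conjugate_terms j)) => k.
have [hk|hk] := ltP k (- n%:Z); first by rewrite /= g_supp // rmorph0 mul0r vge0.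
have [hw ho] := phi_pow_f hk.
have [hkM|hkM] := boolP ((k <= M) || (0 <= M)).
  have -> : C + n%:R * (q%:R * w) - j%:~R * w =
    (C - k%:~R * w) + (n%:R * (q%:R * w) + k%:~R * w - j%:~R * w) by ring.
  by apply: vgeM => //; rewrite /= (vge_iota ext); apply: hg; apply/orP.
(* Here M < 0 and k > M: the order is at least n + k if k < 0 and at least n otherwise, in both
   cases more than n + M >= j. *)
rewrite ho ?mulr0 ?vge0 //; case: ifP; lia.
Qed.

(** The ring of series over K(a) depends on a. Stating the result for a coefficient y in L hides
    this ring, so that the contributions of different a can be added. *)
Lemma conjugate_product j : exists y, [/\
    vcvg vL (lpartial (fun i => iota ((phiK ^+ n) i) * G (j - i))) y,
    j < 0 -> y = 0 &
    forall (M : int) C, (forall k, k <= M \/ 0 <= M -> vge vK (g k) (C - k%:~R * w)) ->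
      j <= M + n%:Z -> vge vL y (C + n%:R * (q%:R * w) - j%:~R * w)].
Proof.
exists ((toL phiK ^+ n * Gr) j); split; first exact: conjugate_cvg.
  exact: conjugate_lord.
by move=> M C; exact: conjugate_weight.
Qed.

End Conjugate.

(** * Recovering h from h(phi) *)

Section CompositionWithPhi.
Variables (K : fieldType) (vK : valuation K) (pi : K) (q : nat).
Variable F : formal_module vK.
Hypotheses (hK : local_field vK pi q) (hF : lubin_tate pi q F).

Let w : rat := (q%:R - 1)^-1.
Let w_gt0 : 0 < w := w_gt0 hK.
Let w_q : (q%:R - 1) * w = 1 := w_q hK.
Let SK := full_csub (local_complete hK).
Let phi : rlaur SK := phiK F hK.

Variable theta : rlaur SK.
Hypothesis phi_theta : phi * theta = 1.
Implicit Types (h x : rlaur SK).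

Let qw_gt0 : 0 < q%:R * w.
Proof. by rewrite mulr_gt0 // ltr0n ltnW // (q_gt1 hK). Qed.

Definition comp_phi : rlaur SK -> rlaur SK :=
  rlcomp phi_theta (ltW w_gt0) qw_gt0 (lw_phiK hK hF) (lord_phiK0 F hK).

Lemma comp_phi_cont h x j : lord x 0 ->
  vcvg vK (lpartial (fun k => h k * (x * pw phi theta k) j)) ((x * comp_phi h) j).
Proof. exact: rlcomp_cont. Qed.

Lemma comp_phi_cvg h m :
  vcvg vK (lpartial (fun k => h k * pw phi theta k m)) (comp_phi h m).
Proof. exact: rlcomp_cvg. Qed.

Lemma comp_phi_lge h c : lge h c -> lge (comp_phi h) c.
Proof. by move=> hh m; exact: (lcomp_vge phi_theta (ltW w_gt0) qw_gt0 (lw_phiK hK hF) m hh). Qed.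

Lemma comp_phi_near h b k : lge h b -> vge vK (comp_phi h (q%:Z * k) - h k) (b + 1).
Proof.
move=> hb; apply: rlcomp_sub => //; first by have := q_gt1 hK; lia.
exact: rlps_near (phi_near hK hF).
Qed.

Lemma comp_phiD h h' : comp_phi (h + h') = comp_phi h + comp_phi h'.
Proof.
apply: rlaurP => m; rewrite rlD; apply: vcvg_unique (comp_phi_cvg _ m) _.
apply: (eq_vcvg _ (vcvgD (comp_phi_cvg h m) (comp_phi_cvg h' m))) => n.
by rewrite /lpartial -big_split; apply: eq_bigr => i _; rewrite rlD mulrDl.
Qed.

Lemma lord_phiX n : lord (phi ^+ n) n.
Proof. by have := lordX (n := n) (@lord_phiK _ _ _ _ F hK); rewrite natz. Qed.

Lemma lord_phiX0 n : lord (phi ^+ n) 0.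
Proof. by move=> m hm; apply: lord_phiX; lia. Qed.

Lemma phiX_lead n : (phi ^+ n) n = pi ^+ n.
Proof.
elim: n => [|n IH]; first by rewrite rl1.
rewrite exprS coef_rlM; [|exact: (lord_phiK0 F hK)|exact: lord_phiX0].
rewrite big_ord_recl [phi _](@lord_phiK _ _ _ _ F hK) // mul0r add0r.
rewrite (bigD1 (Ordinal (ltn0Sn n))) //= big1 => [|i hi].
  rewrite addr0 exprS -IH; congr (_ * _); first exact: (phi1 F hK).
  by congr ((phi ^+ n) _); rewrite /bump /=; lia.
rewrite (lord_phiX (n := n)) ?mulr0 //.
have : i != 0 :> nat by apply: contra hi => /eqP e; apply/eqP/val_inj.
by rewrite /bump /=; lia.
Qed.

Section Support.
Variables (h : rlaur SK) (n : nat).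
Hypothesis hn : lord (phi ^+ n * comp_phi h) 0.

(* phi = T^q modulo pi, so a nonzero coefficient of h below -n would show up,
   modulo a higher power of pi, in phi^n h(phi). *)
Lemma support_from_comp : lord h (- n%:Z).
Proof.
pose h1 := rlpart (fun k => k < - n%:Z) h; pose h2 := rlpart (fun k => - n%:Z <= k) h.
have h12 : h = h1 + h2.
  apply: rlaurP => k; rewrite rlD /=; case: ltP => _; first by rewrite addr0.
  by rewrite add0r.
have hn2 : lord (phi ^+ n * comp_phi h2) 0.
  move=> j j0; apply: (@vge_inf _ vK) => c.
  apply: (lcvg_vge (comp_phi_cont h2 j (lord_phiX0 n))) => k.
  have -> : h2 k = if - n%:Z <= k then h k else 0 by [].
  case: ifP => hk; last by rewrite mul0r vge0.
  rewrite pwD //; have [d ->] : exists d : nat, n%:Z + k = d by exists (absz (n%:Z + k)); lia.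
  by rewrite lord_phiX0 // mulr0 vge0.
have hn1 : lord (phi ^+ n * comp_phi h1) 0.
  move=> j j0; have := hn j0; rewrite {1}h12 comp_phiD mulrDr rlD.
  by rewrite (hn2 j j0) addr0.
have phi_n : lge (phi ^+ n - rlmono SK (q%:Z *+ n)) 1.
  rewrite -rlmonoX; apply: lgeX_sub; exact: rlps_near (phi_near hK hF).
suff h1_0 : h1 = 0.
  move=> k hk; have := congr1 (fun x : rlaur SK => x k) h1_0.
  by rewrite rl0 /= hk.
(* Suppose pi^V divides h1. Modulo pi^(V+1) the coefficient of h1 at k equals that of h1(phi) at qk,
   hence that of phi^n h1(phi) at q(k + n); the latter vanishes since k < -n. *)
apply: rl_eq0; elim=> [|V IH]; first exact: rl_int.
move=> k; have [hk|hk] := ltP k (- n%:Z); last by rewrite /= ltNge hk /= vge0.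
have hV := comp_phi_near k IH.
rewrite vge_subC natr1 in hV; apply: (vge_sub hV).
have -> : comp_phi h1 (q%:Z * k) = (rlmono SK (q%:Z *+ n) * comp_phi h1) (q%:Z * k + q%:Z *+ n).
  by rewrite lmonoM_coef addrK.
have : lge ((phi ^+ n - rlmono SK (q%:Z *+ n)) * comp_phi h1) (1 + V%:R).
  by apply: lgeM => //; exact: comp_phi_lge.
move=> /(_ (q%:Z * k + q%:Z *+ n)).
rewrite mulrBl rlB hn1 ?sub0r ?vgeN ?nat1r //.
have := q_gt1 hK; rewrite -mulr_natr natz -mulrDr; nia.
Qed.

Hypothesis h_supp : lord h (- n%:Z).

Lemma coef_comp_phi (j : nat) :
  (phi ^+ n * comp_phi h) j = \sum_(i < j.+1) h (- n%:Z + i%:Z) * (phi ^+ i) j.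
Proof.
have := @lcvg_fin _ vK _ _ (- n%:Z) j.+1 (comp_phi_cont h j (lord_phiX0 n)).
move=> -> => [|k [hk|hk]].
- by apply: eq_bigr => i _; rewrite pwD // addrA subrr add0r.
- by rewrite h_supp ?mul0r.
rewrite pwD //; have [d ed] : exists d : nat, n%:Z + k = d by exists (absz (n%:Z + k)); lia.
by rewrite ed (lord_phiX (n := d)) ?mulr0 //; lia.
Qed.

(* The coefficient of T^i in phi^i is pi^i, hence the loss of i(1 + w) = iqw. *)
Lemma triangular_weight (M : int) C :
  (forall j : nat, j%:Z <= M + n%:Z ->
     vge vK ((phi ^+ n * comp_phi h) j) (C + n%:R * (q%:R * w) - j%:R * w)) ->
  forall m, m <= M -> vge vK (h m) (C - m%:~R * (q%:R * w)).
Proof.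
move=> hX m hm; have [hmn|hmn] := ltP m (- n%:Z); first by rewrite h_supp ?vge0.
have [i ei] : exists i : nat, m = - n%:Z + i%:Z by exists (absz (m + n%:Z)); lia.
have -> : m%:~R = - n%:R + i%:R :> rat by rewrite ei rmorphD rmorphN /= -!pmulrn.
rewrite ei; have {hm hmn ei m} : i%:Z <= M + n%:Z by lia.
elim/ltn_ind: i => i IH hi.
have pi0 := lf_pi_neq0 hK.
have key : vge vK (h (- n%:Z + i%:Z) * pi ^+ i) (C + n%:R * (q%:R * w) - i%:R * w).
  have -> : h (- n%:Z + i%:Z) * pi ^+ i = (phi ^+ n * comp_phi h) i -
      \sum_(l < i) h (- n%:Z + l%:Z) * (phi ^+ l) i.
    by rewrite coef_comp_phi big_ord_recr /= phiX_lead addrAC subrr add0r.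
  apply: vgeB; first exact: hX.
  apply: vge_sum => l _; have li := ltn_ord l.
  have -> : C + n%:R * (q%:R * w) - i%:R * w =
    (C - (- n%:R + l%:R) * (q%:R * w)) + (l%:R * (q%:R * w) - i%:R * w) by ring.
  apply: vgeM; first by apply: IH => //; lia.
  exact: (lwX l (lw_phiK hK hF) i).
have [->|h0] := eqVneq (h (- n%:Z + i%:Z)) 0; first exact: vge0.
move: key; rewrite !vge_val ?mulf_neq0 ?expf_neq0 // vfunM ?expf_neq0 //.
rewrite vfunX // (lf_pi hK) mulr1.
have : i%:R * ((q%:R - 1) * w) = i%:R by rewrite w_q mulr1.
by move=> e1 e2; lra.
Qed.

End Support.

End CompositionWithPhi.

(** * One application of the trace *)

Section OneStep.
Variables (K : fieldType) (vK : valuation K) (pi : K) (q : nat).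
Variables (L : closedFieldType) (iota : {rmorphism K -> L}) (vL : valuation L).
Variables (F : formal_module vK) (Tr : laurent K -> laurent K).
Hypotheses (hK : local_field vK pi q) (hL : alg_closure iota).
Hypotheses (ext : extends_val iota vK vL) (hF : lubin_tate pi q F).
Hypothesis hTr : is_coleman_trace vL iota pi F Tr.

Let w : rat := (q%:R - 1)^-1.
Let SK := full_csub (local_complete hK).

Lemma one_step (g : laurent K) (n : nat) :
  in_R vK g -> (forall k, k < - n%:Z -> g k = 0) ->
  [/\ in_R vK (Tr g), forall k, k < - n%:Z -> Tr g k = 0 &
    forall (M : int) C,
      (forall k, k <= M \/ 0 <= M -> vge vK (g k) (C - k%:~R * w)) ->
      forall m, m <= M -> vge vK (Tr g m) (C - 1 - m%:~R * (q%:R * w))].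
Proof.
move=> hg g_supp.
have w0 : 0 < w by exact: w_gt0 hK.
have [theta phi_theta] := phiK_inverse hK hF.
have [rs [rs_uniq rs_size rs_tor rs_w]] := torsion_seq hK hL ext hF.
have rs_phi a : a \in rs ->
    vcvg vL (fun N => \sum_(j < N) iota (Defs.coef1 (fm_act F pi) j) * a ^+ j) 0.
  by move=> ha; have : torsion vL iota pi F a; [rewrite rs_tor|case].
pose gr : rlaur SK := RLaur (S := SK) hg (fun=> I).
have gQ : in_Q vK pi g.
  by exists 0%N; rewrite (_ : (fun m => _) = g) //; apply/funext => m; rewrite mul1r.
have [[e he] hT] := hTr gQ.
pose G a m := lcomp vL (fun k => iota (g k)) (translate vL iota F a) m.
pose H m := lcomp vK (Tr g) (laurent_of_ps (Defs.coef1 (fm_act F pi))) m.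
have pi0 : iota pi != 0 by rewrite fmorph_eq0 (lf_pi_neq0 hK).
have eH m : iota (pi * H m) = \sum_(a <- rs) G a m.
  by rewrite rmorphM hT mulrA divff // mul1r rs_tor -fsbig_seq.
(* Modulo the maximal ideal all q conjugates of g agree with g. *)
have H_int m : vge vK (H m) 0.
  (* The valuation of K is discrete, so positive valuation of pi H already means divisibility by
     pi. *)
  apply: (vge_divpi hK); rewrite add0r -(vgt0E hK).
  have : vge vL (iota (pi * H m)) (Num.min w 1).
    have -> : iota (pi * H m) = \sum_(a <- rs) (G a m - iota (g m)) + q%:R * iota (g m).
      by rewrite sumrB eH big_const_seq count_predT rs_size iter_addr_0 mulr_natl subrK.
    apply: vgeD.
      rewrite big_seq; apply: vge_sum => a ha.
      apply: (@vge_le _ _ w); first by rewrite ge_min lexx.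
      exact: (conjugate_near hL ext phi_theta (rs_w a ha) (rs_phi a ha) gr m).
    apply: (@vge_le _ _ 1); first by rewrite ge_min lexx orbT.
    rewrite -(rmorph_nat iota) -rmorphM (vge_iota ext); apply: vgeMr; last exact: hg.1.
    exact: vge_q hK.
  rewrite (vge_iota ext) /vge /vgt => /orP[->//|h].
  by rewrite (lt_le_trans _ h) ?orbT // lt_min w0 ltr01.
pose hr : rlaur SK := RLaur (S := SK) he (fun=> I).
(* [H] is defined by a limit with a default value. Its convergence is deduced from that of the
   substitution into pi^e Tr g, which lies in the ring. *)
have eHr m : comp_phi hF phi_theta hr m = pi ^+ e * H m.
  have := comp_phi_cvg hF phi_theta hr m.
  move=> /(vcvgMl (pi ^- e)) h.
  suff -> : H m = pi ^- e * comp_phi hF phi_theta hr m.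
    by rewrite mulrA divff ?mul1r // expf_neq0 // (lf_pi_neq0 hK).
  rewrite /H /lcomp /lsum; apply: vlimE; apply: eq_vcvg h => N.
  rewrite /lpartial mulr_sumr; apply: eq_bigr => i _.
  rewrite (lpowE (f := phiK F hK) _ phi_theta) /= !mulrA mulVf ?mul1r //.
  by rewrite expf_neq0 // (lf_pi_neq0 hK).
(* [hTr] provides only some e for which pi^e Tr g is integral. As pi^e H is divisible by pi^e and
   phi = T^q modulo pi, the series pi^e Tr g is divisible by pi^e as well, one power of pi at a
   time. *)
have hr_e V : (V <= e)%N -> lge hr V%:R.
  elim: V => [|V IH] hV; first exact: rl_int.
  move=> k; have := comp_phi_near hF phi_theta k (IH (ltnW hV)).
  rewrite vge_subC natr1 => /vge_sub; apply; rewrite eHr.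
  apply: vgeMr; last exact: H_int.
  by apply: vge_le (vge_pi hK e); rewrite ler_nat.
have T_int m : vint vK (Tr g m).
  have := hr_e e (leqnn e) m; rewrite /=.
  have [->|T0] := eqVneq (Tr g m) 0; first by rewrite /vint vge0.
  rewrite /vint !vge_val ?mulf_neq0 ?expf_neq0 ?(lf_pi_neq0 hK) //.
  rewrite vfunM ?expf_neq0 ?(lf_pi_neq0 hK) // vfunX ?(lf_pi_neq0 hK) // (lf_pi hK).
  by move=> ?; lra.
have T_R : in_R vK (Tr g).
  apply: in_R_intro => // c; have [N hN] := in_R_tail (c + e%:R) he; exists N => i /hN.
  have [->|T0] := eqVneq (Tr g i) 0; first by rewrite !vge0.
  rewrite !vge_val ?mulf_neq0 ?expf_neq0 ?(lf_pi_neq0 hK) //.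
  rewrite vfunM ?expf_neq0 ?(lf_pi_neq0 hK) // vfunX ?(lf_pi_neq0 hK) // (lf_pi hK).
  by move=> ?; lra.
pose h : rlaur SK := RLaur (S := SK) T_R (fun=> I).
pose X := phiK F hK ^+ n * comp_phi hF phi_theta h.
have conj j a : exists y, a \in rs -> [/\
    vcvg vL (lpartial (fun i => iota ((phiK F hK ^+ n) i) * G a (j - i))) y,
    j < 0 -> y = 0 &
    forall (M : int) C, (forall k, k <= M \/ 0 <= M -> vge vK (g k) (C - k%:~R * w)) ->
      j <= M + n%:Z -> vge vL y (C + n%:R * (q%:R * w) - j%:~R * w)].
  have [ha|] := boolP (a \in rs); last by exists 0.
  have [y hy] := conjugate_product hL ext hF phi_theta (rs_w a ha) (rs_phi a ha)
    (g := gr) (n := n) g_supp j.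
  by exists y.
(* The defining equation of the trace multiplied by phi^n, read in L one coefficient at a time. *)
have eX j : exists y : L -> L, iota (pi * X j) = \sum_(a <- rs) y a /\
    forall a, a \in rs -> (j < 0 -> y a = 0) /\
    forall (M : int) C, (forall k, k <= M \/ 0 <= M -> vge vK (g k) (C - k%:~R * w)) ->
      j <= M + n%:Z -> vge vL (y a) (C + n%:R * (q%:R * w) - j%:~R * w).
  have /choice[y hy] := conj j; exists y; split; last by move=> a /hy[].
  have h1 := vcvg_iota ext (vcvgMl pi (rlM (phiK F hK ^+ n) (comp_phi hF phi_theta h) j)).
  apply: vcvg_unique h1 _.
  rewrite big_seq.
  have h2 : vcvg vL (fun N => \sum_(a <- rs | a \in rs)
      lpartial (fun i => iota ((phiK F hK ^+ n) i) * G a (j - i)) N) (\sum_(a <- rs | a \in rs) y a).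
    by apply: vcvg_sum => a /hy[].
  apply: eq_vcvg h2 => N.
  rewrite -big_seq /lpartial exchange_big mulr_sumr rmorph_sum; apply: eq_bigr => i _ /=.
  by rewrite -mulr_sumr -eH [in RHS]mulrCA [RHS]rmorphM.
have T_supp : lord h (- n%:Z).
  apply: (@support_from_comp _ _ _ _ F hK hF theta phi_theta h n) => j j0.
  have [y [e1 e2]] := eX j; move: e1; rewrite big_seq big1 => [|a /e2[-> //]].
  by move=> /eqP; rewrite fmorph_eq0 mulf_eq0 (negPf (lf_pi_neq0 hK)) => /eqP.
split=> // M C hM.
apply: (@triangular_weight _ _ _ _ F hK hF theta phi_theta h n T_supp M (C - 1)) => j hj.
apply: (vge_divpi hK); rewrite -(vge_iota ext).
have [y [-> e2]] := eX j; rewrite big_seq; apply: vge_sum => a /e2[_ /(_ M C hM hj)].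
by apply: vge_le; rewrite -pmulrn -/w; lra.
Qed.

End OneStep.

(** * Iteration and rounding *)

Section Iteration.
Variables (K : fieldType) (vK : valuation K) (pi : K) (q : nat).
Variables (L : closedFieldType) (iota : {rmorphism K -> L}) (vL : valuation L).
Variables (F : formal_module vK) (Tr : laurent K -> laurent K).
Hypotheses (hK : local_field vK pi q) (hL : alg_closure iota).
Hypotheses (ext : extends_val iota vK vL) (hF : lubin_tate pi q F).
Hypothesis hTr : is_coleman_trace vL iota pi F Tr.

Let w : rat := (q%:R - 1)^-1.
Let w_gt0 : 0 < w := w_gt0 hK.
Let w_q : (q%:R - 1) * w = 1 := w_q hK.
Let step := one_step hK hL ext hF hTr.

(** The valuation of x is an integer z >= b, and y < z + 1 forces the floor of y to be at most z.
    Integrality of x accounts for the maximum with 0. *)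
Lemma vge_floor_plus x b y : vint vK x -> vge vK x b ->
  (forall z : int, b <= z%:~R -> y < z%:~R + 1) -> vge vK x (floor_plus y)%:~R.
Proof.
have [->|x0] := eqVneq x 0; first by move=> *; exact: vge0.
rewrite /vint !vge_val //; have [z ->] := lf_discrete hK x0 => z0 bz /(_ z bz) yz.
rewrite ler0z in z0; rewrite ler_int /floor_plus ge_max z0 /=.
rewrite leNgt; apply/negP => hz; have : (z + 1 <= Num.floor y)%R by lia.
by rewrite floor_ge_int rmorphD /= leNgt yz.
Qed.

(** With N = floor(n / q^s) the step yields (N - (q - 1) - kq) w. For N' = floor(N / q) and k < N'
    this is at least (N' - k) w, because N >= qN' and (q - 1)(N' - k - 1) >= 0. For k >= N' the
    bound (N' - k) w is not positive and integrality suffices. Thus C is divided by q, up to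
    rounding, at each step. *)
Lemma iter_pos n s : let g := iter s Tr (lmono K n%:Z) in
  [/\ in_R vK g, forall k, k < 0 -> g k = 0 &
    forall k : int, vge vK (g k) ((n %/ q ^ s)%N%:R * w - k%:~R * w)].
Proof.
have q1 := q_gt1 hK.
elim: s => [|s [g_R g_supp g_w]] /=.
  split; first exact: in_R_lmono.
    by move=> k k0; rewrite /lmono (_ : (k == n%:Z) = false) //; lia.
  move=> k; rewrite /lmono; case: eqP => [->|_]; last exact: vge0.
  by rewrite expn0 divn1 subrr; exact: vint1.
have [h_R h_supp h_w] := step (n := 0) g_R g_supp.
split=> // k; have [k0|k0] := ltP k 0; first by rewrite h_supp ?vge0.
set N := (n %/ q ^ s)%N; set N' := (n %/ q ^ s.+1)%N.
have [kN|kN] := leP N'%:Z k.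
  apply: vge_le (h_R.1 k); rewrite -mulrBl pmulr_lle0 // subr_le0.
  by rewrite -(ler_int rat) in kN.
apply: vge_le (h_w k (N%:R * w) (fun j _ => g_w j) k (lexx k)).
have hN : (q%:R * N'%:R <= N%:R :> rat).
  rewrite -natrM ler_nat /N' expnSr divnMA mulnC; exact: leq_divM.
have kN1 : k%:~R + 1 <= N'%:R :> rat.
  have : k + 1 <= N'%:Z by lia.
  by rewrite -(ler_int rat) rmorphD.
have h1 : 0 <= (N%:R - q%:R * N'%:R) * w by rewrite mulr_ge0 ?(ltW w_gt0) // subr_ge0.
have h2 : 0 <= N'%:R - k%:~R - 1 :> rat by lra.
have h3 : (N'%:R - k%:~R) * ((q%:R - 1) * w) = N'%:R - k%:~R by rewrite w_q mulr1.
rewrite -/w; lra.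
Qed.

(** Each step changes the bound at index m by -1 - m(q - 1)w = -1 - m. For m >= 0 the bound is not
    positive, and integrality suffices. *)
Lemma iter_neg n s : let g := iter s Tr (lmono K (- n%:Z)) in
  [/\ in_R vK g, forall k, k < - n%:Z -> g k = 0 &
    forall k : int, vge vK (g k) (- s%:R - s%:R * k%:~R - (n%:R + k%:~R) * w)].
Proof.
elim: s => [|s [g_R g_supp g_w]] /=.
  split; first exact: in_R_lmono.
    by move=> k k0; rewrite /lmono (_ : (k == - n%:Z) = false) //; lia.
  move=> k; rewrite /lmono; case: eqP => [->|_]; last exact: vge0.
  by rewrite rmorphN /= -pmulrn subrr !mul0r !subr0 oppr0; exact: vint1.
have [h_R h_supp h_w] := step g_R g_supp.
split=> // m; have [mn|mn] := ltP m (- n%:Z); first by rewrite h_supp ?vge0.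
have n_m : 0 <= n%:R + m%:~R :> rat.
  by rewrite pmulrn -rmorphD ler0z; lia.
have hnm : 0 <= (n%:R + m%:~R) * w by rewrite mulr_ge0 // ltW.
have [m0|m0] := leP 0 m.
  apply: vge_le (h_R.1 m).
  have : 0 <= s.+1%:R * m%:~R :> rat by rewrite mulr_ge0 ?ler0z.
  have : 0 <= s.+1%:R :> rat by [].
  by lra.
(* The largest C compatible with the bound at k = m. It also serves for k < m, where -sk >= -sm; for
   this the step is applied with M = m < 0. *)
have hC k : k <= m \/ 0 <= m ->
    vge vK (iter s Tr (lmono K (- n%:Z)) k) (- s%:R - s%:R * m%:~R - n%:R * w - k%:~R * w).
  move=> [km|]; last by lia.
  apply: vge_le (g_w k).
  have : s%:R * k%:~R <= s%:R * m%:~R :> rat by rewrite ler_wpM2l // ler_int.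
  by lra.
apply: vge_le (h_w m _ hC m (lexx m)).
have h3 : m%:~R * ((q%:R - 1) * w) = m%:~R by rewrite w_q mulr1.
by rewrite -natr1; rewrite -/w; lra.
Qed.

End Iteration.

Theorem theorem1p5
  (K : fieldType) (vK : valuation K) (pi : K) (q : nat)
  (L : closedFieldType) (iota : {rmorphism K -> L}) (vL : valuation L)
  (F : formal_module vK) (Tr : laurent K -> laurent K) (s n : nat)
  (hK : local_field vK pi q)
  (hL : alg_closure iota) (hvL : extends_val iota vK vL)
  (hF : lubin_tate pi q F)
  (hTr : is_coleman_trace vL iota pi F Tr)
  (hs : (0 < s)%N) (hn : (0 < n)%N) :
  (forall m : nat,
     vge vK (iter s Tr (lmono K n%:Z) m%:Z)
       (floor_plus ((n%:R - q%:R ^+ s.-1 - m%:R * q%:R ^+ s)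
                    / ((q%:R - 1) * q%:R ^+ s.-1)))%:~R)
  /\
  (forall m : int, - n%:Z <= m ->
     vge vK (iter s Tr (lmono K (- n%:Z)) m)
       (floor_plus (((q%:R - 1) * (1 - s%:R - s%:R * m%:~R) - m%:~R - n%:R - 1)
                    / (q%:R - 1)))%:~R).
Proof.
have q1 := q1_gt0 hK; have w_q := w_q hK.
have q0 : 0 < q%:R :> rat by lra.
split=> m.
  case: s hs => [//|s] _ /=.
  (* The last application is left to [one_step], whose bound has slope -qw in m, as the claim
     requires; the bound of [iter_pos] has slope -w only. *)
  have [g_R g_supp g_w] := iter_pos hK hL hvL hF hTr n s.
  have [h_R _ h_w] := one_step hK hL hvL hF hTr (n := 0) g_R g_supp.
  apply: (vge_floor_plus hK (h_R.1 m) (h_w m _ (fun j _ => g_w j) m (lexx _))) => z.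
  set N := (n %/ q ^ s)%N; set w := (q%:R - 1)^-1.
  (* Hence the argument (n / q^s - 1 - mq) w of the floor is less than (N - mq) w, which is the
     bound just obtained plus 1. *)
  have hn' : n%:R < (N%:R + 1) * q%:R ^+ s :> rat.
    by rewrite natr1 -natrX -natrM ltr_nat ltn_ceil // expn_gt0 ltnW // (q_gt1 hK).
  have Q0 : 0 < q%:R ^+ s :> rat by rewrite exprn_gt0.
  rewrite -pmulrn => hz; rewrite ltr_pdivrMr ?mulr_gt0 //.
  have hz' : N%:R - (q%:R - 1) - m%:R * q%:R <= z%:~R * (q%:R - 1) :> rat.
    have e1 : N%:R * ((q%:R - 1) * w) = N%:R by rewrite w_q mulr1.
    have e2 : m%:R * q%:R * ((q%:R - 1) * w) = m%:R * q%:R by rewrite w_q mulr1.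
    have : (N%:R * w - 1 - m%:R * (q%:R * w)) * (q%:R - 1) <= z%:~R * (q%:R - 1).
      by rewrite ler_pM2r.
    by lra.
  have : (N%:R - (q%:R - 1) - m%:R * q%:R) * q%:R ^+ s <= z%:~R * (q%:R - 1) * q%:R ^+ s :> rat.
    by rewrite ler_pM2r.
  by rewrite exprS; lra.
move=> hm; have [g_R _ g_w] := iter_neg hK hL hvL hF hTr n s.
(* The argument of the floor exceeds the bound of [iter_neg] by 1 - w, which is less than 1. *)
apply: (vge_floor_plus hK (g_R.1 m) (g_w m)) => z hz.
rewrite ltr_pdivrMr //.
have : (- s%:R - s%:R * m%:~R - (n%:R + m%:~R) * (q%:R - 1)^-1) * (q%:R - 1) <= z%:~R * (q%:R - 1) :> rat.
  by rewrite ler_pM2r.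
have : (n%:R + m%:~R) * ((q%:R - 1) * (q%:R - 1)^-1) = n%:R + m%:~R :> rat by rewrite w_q mulr1.
by lra.
Qed.
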